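(* Let $K\subset\mathbb{R}^n$ be compact, $\ell\in\mathbb{N}_0$, $f\in C^\ell(K,\mathbb{R})$, and let $\sigma\in C^\ell(\mathbb{R})$ be $\ell$-finite. Let $((b_j,C_j))_{j\in\mathbb{N}}$ be i.i.d. random variables with values in $\mathbb{R}\times\mathbb{R}^n$ and full support. Then for every $0\le r\le\ell$, $\alpha\in(0,1)$ and $\epsilon>0$ there exists $N\in\mathbb{N}$ such that, with probability greater than $\alpha$, there exist $W_1,\dots,W_N\in\mathbb{R}$ for which the function $g:K\to\mathbb{R}$, $g(x)=\sum_{j=1}^NW_j\sigma(C_j^\top x+b_j)$, satisfies $\|f-g\|_{C^r}<\epsilon$.
   Context: $\sigma\in C^\ell(\mathbb{R})$ is called $\ell$-finite if $0<\int_{\mathbb{R}}|\sigma^{(\ell)}(x)|\,dx<\infty$. $C^\ell(K,\mathbb{R})$ denotes restrictions to $K$ of $C^\ell$ functions on a neighbourhood of $K$, and $\|h\|_{C^r}$ is the sum over multi-indices of order $\le r$ of the suprema over $K$ of the absolute values of the corresponding partial derivatives of $h$. Full support means every nonempty open set has positive probability. *)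

(* Defs.v *)
From HB Require Import structures.
From mathcomp Require Import all_boot all_order all_algebra.
From mathcomp Require Import all_classical all_reals all_analysis.
Set Implicit Arguments. Unset Strict Implicit. Unset Printing Implicit Defensive.
Import Order.TTheory GRing.Theory Num.Theory.
Import numFieldNormedType.Exports.
Local Open Scope classical_set_scope.
Local Open Scope ring_scope.

Section Defs.
Variable R : realType.

Definition evec (n : nat) (i : 'I_n) : 'rV[R]_n := delta_mx 0 i.

Definition pderiv (n : nat) (i : 'I_n) (h : 'rV[R]_n -> R) : 'rV[R]_n -> R :=
  fun x => 'D_(evec i) h x.

Fixpoint pds (n : nat) (s : seq 'I_n) (h : 'rV[R]_n -> R) : 'rV[R]_n -> R :=
  match s with
  | [::] => h
  | i :: s' => pderiv i (pds s' h)
  end.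

Definition Cl_on (n : nat) (U : set 'rV[R]_n) (l : nat) (h : 'rV[R]_n -> R) : Prop :=
  (forall (s : seq 'I_n), (size s < l)%N ->
     forall (i : 'I_n) (x : 'rV[R]_n), U x -> derivable (pds s h) x (evec i)) /\
  (forall (s : seq 'I_n), (size s <= l)%N ->
     forall x : 'rV[R]_n, U x -> {for x, continuous (pds s h)}).

Definition morder (n r : nat) (a : {ffun 'I_n -> 'I_r.+1}) : nat :=
  (\sum_(i < n) (a i : nat))%N.

Definition pdm (n r : nat) (a : {ffun 'I_n -> 'I_r.+1}) (h : 'rV[R]_n -> R)
  : 'rV[R]_n -> R :=
  pds (flatten [seq nseq (a i : nat) i | i <- enum 'I_n]) h.

Definition Crnorm (n r : nat) (K : set 'rV[R]_n) (h : 'rV[R]_n -> R) : R :=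
  \sum_(a : {ffun 'I_n -> 'I_r.+1} | (morder a <= r)%N)
     sup [set `|pdm a h x| | x in K].

Definition Cl_R (l : nat) (sigma : R -> R) : Prop :=
  (forall k, (k < l)%N -> forall x : R, derivable (derive1n k sigma) x 1) /\
  (forall k, (k <= l)%N -> continuous (derive1n k sigma)).

Definition l_finite (l : nat) (sigma : R -> R) : Prop :=
  Cl_R l sigma /\
  (0 < \int[lebesgue_measure]_x (`|derive1n l sigma x|)%:E < +oo)%E.

Definition borelV (m : nat) : set (set 'rV[R]_m) := <<s setT, open >>.

Context (d : measure_display) (Omega : measurableType d) (P : probability Omega R).

Definition iid_full_support (m : nat) (X : nat -> Omega -> 'rV[R]_m) : Prop :=
  (forall j (B : set 'rV[R]_m), borelV B -> measurable (X j @^-1` B)) /\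
  (forall (J : seq nat) (B : nat -> set 'rV[R]_m),
     uniq J -> (forall j, borelV (B j)) ->
     P (\bigcap_(j in [set` J]) (X j @^-1` B j)) =
       (\prod_(j <- J) P (X j @^-1` B j))%E) /\
  (forall j (B : set 'rV[R]_m), borelV B ->
     P (X j @^-1` B) = P (X 0%N @^-1` B)) /\
  (forall j (O : set 'rV[R]_m), open O -> O !=set0 ->
     (0 < P (X j @^-1` O))%E).

End Defs.

Definition pairvec (R : realType) (n : nat) (b : R) (C : 'rV[R]_n) : 'rV[R]_(1 + n) :=
  row_mx (const_mx b) C.

Definition network (R : realType) (n N : nat) (sigma : R -> R) (W : 'I_N -> R)
  (b : nat -> R) (C : nat -> 'rV[R]_n) : 'rV[R]_n -> R :=
  fun x => \sum_(j < N) W j * sigma (\sum_(i < n) C j 0 i * x 0 i + b j).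

(* Main.v *)
Require Import Defs.
From HB Require Import structures.
From mathcomp Require Import all_boot all_order all_algebra.
From mathcomp Require Import all_classical all_reals all_analysis.
From mathcomp Require Import ring lra.
Import Order.TTheory GRing.Theory Num.Theory.
Import numFieldNormedType.Exports.
Local Open Scope classical_set_scope.
Local Open Scope ring_scope.

(** A function on K is replaced by the family of its partial derivatives of
    order at most l, and a family is approximable when it is a uniform limit
    on K of the families of deterministic networks.

    Averaging sigma over unit intervals q times (a limit of Riemann sums of
    translates) keeps ridge functions approximable and yields a function of
    class C^(l+q) whose derivative of order l+q is the q-th difference of
    sigma^(l); this is not identically 0, because an integrable continuous
    function with period 1 vanishes.  Difference quotients in the weights at
    weight 0 then make every monomial approximable.  Truncated powers are
    C^l-limits of polynomials, so tensor products of B-splines are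
    approximable as well.  The spline quasi-interpolant of f at scale h only
    uses values of f near the point of evaluation (so no extension of f
    outside U is needed), and by summation by parts its derivatives are
    convex combinations of divided differences, hence of nearby values of the
    derivatives of f.

    Finally, the derivatives of a neuron depend continuously on its
    parameters, uniformly on K, and with high probability the first N samples
    hit given neighbourhoods of all the finitely many parameters used. *)

Set Implicit Arguments.
Unset Strict Implicit.
Unset Printing Implicit Defensive.

(** * Primitives and the mean value theorem *)

Lemma continuousR (R : realType) (g : R -> R) t e : {for t, continuous g} ->
  0 < e -> exists2 d, 0 < d & forall u, `|t - u| < d -> `|g t - g u| < e.
Proof.
move=> /cvgrPdist_lt /[apply] /nbhs_ballP[d d0 H].
by exists d => // u ud; apply: H.
Qed.

Lemma is_derive_mvt (R : realType) (f df : R -> R) (a b : R) :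
  (forall x : R, is_derive x 1 f (df x)) ->
  exists2 c, `|c - a| <= `|b - a| & f b - f a = df c * (b - a).
Proof.
move=> fd.
have fc : continuous f.
  by move=> x; apply/differentiable_continuous/derivable1_diffP.
have [ab|/ltW ba] := leP a b.
- have [|c] := @MVT_segment R f df a b ab (fun x _ => fd x).
    exact/continuous_subspaceT.
  rewrite in_itv/= => /andP[ac cb] e; exists c => //.
  by rewrite !ger0_norm ?subr_ge0// lerB.
- have [|c] := @MVT_segment R f df b a ba (fun x _ => fd x).
    exact/continuous_subspaceT.
  rewrite in_itv/= => /andP[bc ca] e; exists c.
    by rewrite !ler0_norm ?subr_le0// lerN2 lerB.
  by apply: oppr_inj; rewrite opprB e -mulrN opprB.
Qed.

Lemma is_derive_nondecreasing (R : realType) (f df : R -> R) (a b : R) :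
  (forall x : R, is_derive x 1 f (df x)) -> (forall x, 0 <= df x) ->
  a <= b -> f a <= f b.
Proof.
move=> fd df0 ab; have [c _ e] := is_derive_mvt a b fd.
by rewrite -subr_ge0 e mulr_ge0// subr_ge0.
Qed.

Lemma is_derive_shiftR (R : realType) (f df : R -> R) (c t : R) :
  (forall x : R, is_derive x 1 f (df x)) ->
  is_derive t 1 (fun u => f (u + c)) (df (t + c)).
Proof.
move=> fd; have -> : (fun u => f (u + c)) = f \o (shift c) by [].
rewrite -[df _]mulr1.
exact: (@is_derive1_comp _ f (shift c) t _ 1 (fd _) (is_derive_shift t 1 c)).
Qed.

Section antiderivative.
Context {R : realType}.
Notation mu := (@lebesgue_measure R).

Let G (g : R -> R) (t : R) : R :=
  if 0 <= t then \int[mu]_(u in `]0, t]) g u else - \int[mu]_(u in `]t, 0]) g u.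

Let int_itv (g : R -> R) (a b : R) : continuous g ->
  mu.-integrable `[a, b] (EFin \o g).
Proof.
move=> cg; apply: continuous_compact_integrable.
  exact: segment_compact.
exact/continuous_subspaceT.
Qed.

(** The fundamental theorem of calculus is applied on a bounded interval with fixed left end [- A],
    where [A > |t|]. Near [t] the oriented integral from 0 differs from that primitive by a
    constant. *)
Lemma antiderivative_continuous (g : R -> R) : continuous g ->
  exists G : R -> R, forall t : R, is_derive t 1 G (g t).
Proof.
move=> cg; exists (G g) => t.
pose A : R := `|t| + 1.
have tA : `|t| < A by rewrite /A ltrDl.
have /andP[At1 At2] : - A < t < A by rewrite -ltr_norml.
pose H (u : R) := \int[mu]_(s in `[- A, u]) g s.
have [dH eH] : derivable H t 1 /\ derive1 H t = g t.
  exact: (@continuous_FTC1_closed R g (- A) t A At2 (int_itv (- A) A cg) At1 (cg t)).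
have : is_derive t 1 (fun u => H u - H 0) (g t).
  have h1 : is_derive t 1 H (g t) by apply: (DeriveDef dH); rewrite -eH derive1E.
  have -> : (fun u => H u - H 0) = H - cst (H 0) by [].
  by rewrite -[g t]subr0; apply: is_deriveB.
apply: near_eq_is_derive.
have : \forall y \near t, y \in `]-A, A[.
  by apply: near_in_itvoo; rewrite in_itv/= At1.
have A0 : 0 < A by apply: le_lt_trans tA.
apply: filterS => y; rewrite in_itv/= => /andP[Ay yA].
rewrite /G /H; case: ifPn => y0.
  rewrite Rintegral_itvB ?bnd_simp//.
  - exact: int_itv.
  - by rewrite oppr_le0 ltW.
rewrite -ltNge in y0.
rewrite -(@Rintegral_itvB _ g (BLeft (- A)) (BRight 0) y) ?bnd_simp ?opprB//.
- exact: int_itv.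
- by rewrite ltW.
- by rewrite ltW.
Qed.

(** Turns finiteness of a Lebesgue integral into a bound on increments of a primitive: an increment
    over [[s, t]] integrates a nonnegative function over a subset of the line, and a backward
    increment is at most 0. *)
Lemma antiderivative_bounded (g F : R -> R) : continuous g ->
  (forall t, 0 <= g t) -> (\int[mu]_x (g x)%:E < +oo)%E ->
  (forall t : R, is_derive t 1 F (g t)) ->
  exists B, forall s t, F t - F s <= B.
Proof.
move=> cg g0 gi Fd.
exists (fine (\int[mu]_x (g x)%:E)) => s t.
have cF : continuous F.
  by move=> x; apply/differentiable_continuous/derivable1_diffP.
have i0 : (0 <= \int[mu]_x (g x)%:E)%E.
  by apply: integral_ge0 => x _; rewrite lee_fin.
have [ts|st] := leP t s.
  apply: (@le_trans _ _ 0); last exact: fine_ge0.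
  by rewrite subr_le0; apply: is_derive_nondecreasing ts.
have e : (\int[mu]_(x in `[s, t]) (g x)%:E = (F t)%:E - (F s)%:E)%E.
  apply: continuous_FTC2 => //.
  - exact/continuous_subspaceT.
  - split => [x _||].
    + by have := Fd x.
    + by apply: cvg_at_right_filter; exact: cF.
    + by apply: cvg_at_left_filter; exact: cF.
  - by move=> x _; rewrite derive1E; apply: derive_val.
rewrite -lee_fin EFinB -e fineK; last first.
  by rewrite ge0_fin_numE.
apply: ge0_subset_integral => //.
- by apply/measurable_realfun.measurable_EFinP; exact: measurable_realfun.continuous_measurable_fun.
- by move=> x _; rewrite lee_fin.
Qed.

End antiderivative.

(** * Chains of derivatives and smoothing *)

(** Only [x] has to lie in [K]. Continuity at the points of [K] is meant in the whole space, so
    compactness also controls neighbours outside [K]. *)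
Lemma compact_unif_continuous (R : realType) (V : normedModType R) (K : set V)
    (g : V -> R) e : compact K -> (forall x, K x -> {for x, continuous g}) ->
  0 < e -> exists2 d, 0 < d &
    forall x y, K x -> `|x - y| < d -> `|g x - g y| < e.
Proof.
move=> /compact_near_coveringP cK gc e0.
pose P (d : R) (x : V) := forall y, `|x - y| < d -> `|g x - g y| < e.
have : \forall d \near (0:R)^'+, K `<=` P d.
  apply: cK => x Kx.
  have e20 : 0 < e / 2 by rewrite divr_gt0.
  have /cvgrPdist_lt/(_ _ e20)/nbhs_normP[d d0 H] := gc x Kx.
  have d20 : 0 < d / 2 by rewrite divr_gt0.
  near=> x' d' => y yd.
  have xx' : `|x - x'| < d / 2.
    by near: x'; apply/nbhs_normP; exists (d / 2).
  have d'd : d' < d / 2 by near: d'; exact: nbhs_right_lt.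
  have h1 : `|g x - g x'| < e / 2.
    by apply: H => /=; lra.
  have h2 : `|g x - g y| < e / 2.
    apply: H => /=.
    have -> : x - y = (x - x') + (x' - y) by rewrite addrA subrK.
    apply: le_lt_trans (ler_normD _ _) _.
    by rewrite [ltRHS]splitr; apply: ltrD => //; exact: lt_trans d'd.
  have -> : g x' - g y = (g x - g y) - (g x - g x').
    by ring.
  by have := ler_normB (g x - g y) (g x - g x'); lra.
move=> H.
near (0:R)^'+ => d.
exists d; first by near: d; exact: nbhs_right_gt.
move=> x y Kx xy.
suff : K `<=` P d by move=> /(_ _ Kx); exact.
by near: d.
Unshelve. all: by end_near. Qed.

(** The successive derivatives are given as data, so that passing to a primitive merely shifts the
    family by one index. *)
Definition chain (R : realType) (m : nat) (th : nat -> R -> R) :=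
  (forall j, (j < m)%N -> forall t : R, is_derive t 1 (th j) (th j.+1 t)) /\
  (forall j, (j <= m)%N -> continuous (th j)).

Definition fdiff (R : realType) (u : R -> R) (t : R) := u (t + 1) - u t.

Section chains.
Context {R : realType}.
Implicit Types (th : nat -> R -> R) (u H : R -> R).

Lemma unif_continuous_seg u A e : continuous u -> 0 < e ->
  exists2 d, 0 < d & forall s t, `|s| <= A -> `|s - t| < d -> `|u s - u t| <= e.
Proof.
move=> cu e0.
have [d d0 H] := @compact_unif_continuous R R^o `[- A, A] u e
  (@segment_compact _ _ _) (fun x _ => cu x) e0.
exists d => // s t sA st; apply/ltW/H => //=.
by rewrite in_itv/= -ler_norml.
Qed.

Lemma chain_unif_continuous m th A e : chain m th -> 0 < e ->
  exists2 d, 0 < d & forall j s t, (j <= m)%N -> `|s| <= A -> `|s - t| < d ->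
    `|th j s - th j t| <= e.
Proof.
move=> [_]; elim: m => [|m IH] tc e0.
  have [d d0 H] := unif_continuous_seg A (tc 0%N (leqnn _)) e0.
  by exists d => // j s t; rewrite leqn0 => /eqP ->; exact: H.
have [d d0 H] := IH (fun j jm => tc j (leqW jm)) e0.
have [d' d'0 H'] := unif_continuous_seg A (tc m.+1 (leqnn _)) e0.
exists (Num.min d d'); first by rewrite lt_min d0.
move=> j s t; rewrite leq_eqVlt => /orP[/eqP ->|jm] sA; rewrite lt_min => /andP[sd sd'].
  exact: H'.
exact: H.
Qed.

Lemma chain_bounded m th A : chain m th ->
  exists2 B, 0 < B & forall j t, (j <= m)%N -> `|t| <= A -> `|th j t| <= B.
Proof.
move=> [_]; elim: m => [|m IH] tc.
  have : compact (th 0%N @` `[-A, A]).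
    apply: continuous_compact (@segment_compact _ _ _).
    exact/continuous_subspaceT/tc.
  move=> /compact_bounded[B [_ HB]]; exists (Num.max 1 (B + 1)).
    by rewrite lt_max ltr01.
  move=> j t; rewrite leqn0 => /eqP -> tA; rewrite le_max; apply/orP; right.
  apply: (HB (B + 1)); first by rewrite ltrDl.
  by exists t => //=; rewrite in_itv/= -ler_norml.
have [B B0 H] := IH (fun j jm => tc j (leqW jm)).
have : compact (th m.+1 @` `[-A, A]).
  apply: continuous_compact (@segment_compact _ _ _).
  exact/continuous_subspaceT/tc.
move=> /compact_bounded[B' [_ HB]]; exists (Num.max B (B' + 1)).
  by rewrite lt_max B0.
move=> j t; rewrite leq_eqVlt le_max => /orP[/eqP ->|jm] tA; apply/orP; [right|left].
  apply: (HB (B' + 1)); first by rewrite ltrDl.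
  by exists t => //=; rewrite in_itv/= -ler_norml.
exact: H.
Qed.

Lemma is_derive_fdiff u H : (forall t : R, is_derive t 1 H (u t)) ->
  forall t : R, is_derive t 1 (fdiff H) (fdiff u t).
Proof.
move=> Hu t.
have -> : fdiff H = (fun s => H (s + 1)) - H by [].
by apply: is_deriveB; exact: is_derive_shiftR.
Qed.

Lemma continuous_fdiff u : continuous u -> continuous (fdiff u).
Proof.
move=> cu t; apply: cvgB; last exact: cu.
apply: (@continuous_comp _ _ _ (fun s : R => s + 1) u); last exact: cu.
by apply: cvgD; [exact: cvg_id|exact: cvg_cst].
Qed.

(** Here [th' j] is the integral of [th j] over [[t, t + 1]]. The family consists of the differences
    of a primitive of [th 0], then of [th 0], [th 1] and so on, hence one more derivative is
    available. *)
Lemma chain_smooth m th : chain m th -> exists th', [/\ chain m.+1 th',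
  th' m.+1 = fdiff (th m) &
  forall j, (j <= m)%N -> exists2 H,
    (forall t : R, is_derive t 1 H (th j t)) & th' j = fdiff H].
Proof.
move=> [h1 h2].
have [G HG] := antiderivative_continuous (h2 0%N (leq0n _)).
exists (fun j => if j is j'.+1 then fdiff (th j') else fdiff G); split => //.
- split.
    move=> [|j] jm t; first exact: is_derive_fdiff.
    by apply: is_derive_fdiff; exact: h1.
  move=> [|j] jm; apply: continuous_fdiff.
    by move=> x; apply/differentiable_continuous/derivable1_diffP.
  exact: h2.
- move=> [|j] jm; first by exists G.
  by exists (th j) => //; exact: h1.
Qed.

(** The increment of [H] over [[t, t + 1]] is cut into [N] pieces, and the mean value theorem on
    each compares it with the sample of [u] at the left end. *)
Lemma fdiff_riemann u H (N : nat) (e t : R) : (0 < N)%N ->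
  (forall t : R, is_derive t 1 H (u t)) ->
  (forall s s', `|s| <= `|t| + 1 -> `|s - s'| <= N%:R^-1 -> `|u s - u s'| <= e) ->
  `|fdiff H t - \sum_(i < N) N%:R^-1 * u (t + i%:R / N%:R)| <= e.
Proof.
move=> N0 Hu Hs.
have NR : 0 < N%:R :> R by rewrite ltr0n.
have -> : fdiff H t = \sum_(i < N) (H (t + i.+1%:R / N%:R) - H (t + i%:R / N%:R)).
  rewrite -(big_mkord xpredT (fun i => H (t + i.+1%:R / N%:R) - H (t + i%:R / N%:R))).
  rewrite telescope_sumr// mul0r addr0 divff//.
  by rewrite gt_eqF.
rewrite -sumrB; apply: le_trans (ler_norm_sum _ _ _) _.
have -> : e = \sum_(i < N) e / N%:R.
  by rewrite sumr_const card_ord -[RHS]mulr_natr divfK// gt_eqF.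
apply: ler_sum => i _.
have dd : (t + i.+1%:R / N%:R) - (t + i%:R / N%:R) = N%:R^-1.
  by rewrite -natr1; lra.
have [c] := is_derive_mvt (t + i%:R / N%:R) (t + i.+1%:R / N%:R) Hu.
rewrite dd => cd ->; rewrite [_ * u _]mulrC -mulrBl normrM.
rewrite [X in _ * X]gtr0_norm ?invr_gt0//.
rewrite ler_pM2r ?invr_gt0// distrC; apply: Hs.
  apply: le_trans (ler_normD _ _) _; rewrite lerD2l ger0_norm; last first.
    by rewrite divr_ge0// ltW.
  by rewrite ler_pdivrMr// mul1r ler_nat ltnW.
by rewrite distrC (le_trans cd)// gtr0_norm// invr_gt0.
Qed.

(* The primitive of |u| is dominated by H, so this is integrability of u,
   phrased so that it is visibly stable under translation. *)
Definition dominated_primitive u := exists H dH : R -> R, exists B : R,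
  [/\ forall t : R, is_derive t 1 H (dH t), forall t, `|u t| <= dH t &
      forall s t, H t - H s <= B].

Lemma dominated_primitive_fdiff u :
  dominated_primitive u -> dominated_primitive (fdiff u).
Proof.
move=> [H [dH [B [h1 h2 h3]]]].
exists ((fun t => H (t + 1)) + H), (fun t => dH (t + 1) + dH t), (B + B); split.
- by move=> t; apply: is_deriveD; exact: is_derive_shiftR.
- move=> t; apply: le_trans (ler_normB _ _) _.
  by have := h2 t; have := h2 (t + 1); lra.
- by move=> s t; have := h3 s t; have := h3 (s + 1) (t + 1); rewrite !fctE; lra.
Qed.

(** If [u t] were nonzero, periodicity would make the dominating primitive grow by a fixed positive
    amount over every period, so its increments would be unbounded. *)
Lemma dominated_primitive_periodic u : continuous u -> dominated_primitive u ->
  (forall t, fdiff u t = 0) -> forall t, u t = 0.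
Proof.
move=> cu [H [dH [B [h1 h2 h3]]]] per t.
have pern (n : nat) s : u (s + n%:R) = u s.
  elim: n => [|n IH]; first by rewrite addr0.
  by rewrite -natr1 addrA -IH; apply/eqP; rewrite -subr_eq0; apply/eqP/per.
apply/eqP/contraT => ut0.
have e0 : 0 < `|u t| / 2 by rewrite divr_gt0// normr_gt0.
set e := `|u t| / 2 in e0.
have [d d0 Hd] := continuousR (cu t) e0.
(* The window of length [d'] starting at [t + n] stays inside one period and within distance [d] of
   a translate of [t], where [|u| >= e]. *)
pose d' := Num.min (d / 2) (1 / 2).
have d'0 : 0 < d' by rewrite lt_min; apply/andP; split; lra.
have d'd : d' < d by rewrite gt_min; apply/orP; left; lra.
have d'1 : d' <= 1 / 2 by rewrite ge_min lexx orbT.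
have dH0 s : 0 <= dH s by apply: le_trans (h2 s).
have ul s : `|t - s| < d -> e <= `|u s|.
  by move=> /Hd; have := lerB_dist (u t) (u s); rewrite /e; lra.
have inc (n : nat) : e * d' <= H (t + n.+1%:R) - H (t + n%:R).
  have [c cd hc] := is_derive_mvt (t + n%:R) (t + n%:R + d') h1.
  have -> : H (t + n.+1%:R) - H (t + n%:R) =
    (H (t + n.+1%:R) - H (t + n%:R + d')) + (H (t + n%:R + d') - H (t + n%:R)).
    by rewrite addrA subrK.
  have p1 : 0 <= H (t + n.+1%:R) - H (t + n%:R + d').
    rewrite subr_ge0; apply: (is_derive_nondecreasing h1 dH0).
    by rewrite -natr1; lra.
  rewrite hc.
  have -> : t + n%:R + d' - (t + n%:R) = d' by lra.
  have : e * d' <= dH c * d'.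
    rewrite ler_pM2r//; apply: le_trans (h2 c).
    rewrite -[c](subrK n%:R) pern; apply: ul.
    move: cd; have -> : t + n%:R + d' - (t + n%:R) = d' by lra.
    rewrite (gtr0_norm d'0) distrC => cd.
    have -> : t - (c - n%:R) = t + n%:R - c by lra.
    lra.
  lra.
have incn (n : nat) : n%:R * (e * d') <= H (t + n%:R) - H t.
  elim: n => [|n IH]; first by rewrite mul0r addr0 subrr.
  have := inc n; have -> : n.+1%:R * (e * d') = n%:R * (e * d') + e * d'.
    by rewrite -natr1 mulrDl mul1r.
  lra.
have ed0 : 0 < e * d' by rewrite mulr_gt0.
have B0 : 0 <= B by have := h3 t t; rewrite subrr.
pose n := (Num.truncn (B / (e * d'))).+1.
have : B < n%:R * (e * d').
  by rewrite -ltr_pdivrMr// truncnS_gt.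
by have := incn n; have := h3 t (t + n%:R); lra.
Qed.

Lemma chain_nonzero m p th : chain m th -> (p <= m)%N -> (exists t, th m t != 0) ->
  exists t, th p t != 0.
Proof.
move=> [h1 _]; elim: m h1 => [|m IH] h1.
  by rewrite leqn0 => /eqP ->.
rewrite leq_eqVlt => /orP[/eqP -> //|pm] [t tn0].
apply: IH => //; first by move=> j jm; apply: h1; exact: ltnW.
apply: contrapT => hn; move: tn0.
have h0 : th m = cst 0.
  by apply/funext => s; apply/eqP/contraT => ?; exfalso; apply: hn; exists s.
have := h1 m (leqnn _) t.
rewrite h0 => hd.
have := @derive_val _ _ _ _ _ _ _ hd; rewrite derive_cst => <-.
by rewrite eqxx.
Qed.

End chains.

(** * Taylor expansion and finite differences *)

Section product_bounds.
Context {R : realType}.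

Lemma prod_norm_le (I : finType) (P : pred I) (F : I -> R) B : 1 <= B ->
  (forall i, P i -> `|F i| <= B) -> `|\prod_(i | P i) F i| <= B ^+ #|I|.
Proof.
move=> B1 FB; rewrite normr_prod.
have B0 : 0 <= B by apply: le_trans B1.
apply: (@le_trans _ _ (\prod_(i | P i) B)).
  by apply: ler_prod => i Pi; rewrite normr_ge0 FB.
by rewrite prodr_const; apply: ler_weXn2l => //; exact: max_card.
Qed.

Lemma norm_exp_le (w B : R) (j l : nat) : 1 <= B -> `|w| <= B -> (j <= l)%N ->
  `|w ^+ j| <= B ^+ l.
Proof.
move=> B1 wB jl; rewrite normrX.
have B0 : 0 <= B by apply: le_trans B1.
apply: (@le_trans _ _ (B ^+ j)); first by rewrite lerXn2r.
exact: ler_weXn2l.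
Qed.

Lemma finite_norm_bound (I : finType) (w : I -> R) :
  exists2 B, 1 <= B & forall i, `|w i| <= B.
Proof.
exists (1 + \sum_i `|w i|); first by rewrite lerDl sumr_ge0.
move=> i; rewrite (bigD1 i)//= addrCA lerDl addr_ge0// sumr_ge0//.
Qed.

(** Dividing by [L + 1] instead of [L] covers [L = 0]. This is how most tolerances below are
    chosen. *)
Lemma small_bound (L e : R) : 0 <= L -> 0 < e ->
  exists2 d, 0 < d & L * d <= e.
Proof.
move=> L0 e0; exists (e / (L + 1)); first by rewrite divr_gt0// ltr_wpDl.
rewrite mulrCA ger_pMr// ler_pdivrMr ?ltr_wpDl// mul1r; lra.
Qed.

End product_bounds.

Section taylor.
Context {R : realType}.
Implicit Types (th : nat -> R -> R).

Definition taylor_poly th (c : R) p : {poly R} :=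
  \poly_(r < p) (th r c / r`!%:R).

Lemma taylor_poly_deriv th c p :
  deriv (taylor_poly th c p.+1) = taylor_poly (fun j => th j.+1) c p.
Proof.
apply/polyP => i; rewrite coef_deriv !coef_poly ltnS.
case: ifP => _; last by rewrite mul0rn.
rewrite -[LHS]mulr_natr factS natrM invfM [_^-1 * _^-1]mulrC mulrA.
by rewrite divfK ?pnatr_eq0.
Qed.

(** The remainder is measured by the oscillation of the [p]-th derivative, so no derivative of order
    [p + 1] is required. The induction applies the mean value theorem to the remainder, whose
    derivative is the remainder for the shifted chain. *)
Lemma taylor_bound p th c z e :
  (forall j, (j < p)%N -> forall t : R, is_derive t 1 (th j) (th j.+1 t)) ->
  (forall y, `|y - c| <= `|z| -> `|th p y - th p c| <= e) ->
  `|th 0%N (c + z) - (taylor_poly th c p.+1).[z]| <= e * `|z| ^+ p.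
Proof.
elim: p th z => [|p IH] th z dth hp.
  rewrite /taylor_poly horner_poly big_ord_recl big_ord0 addr0 expr0 mulr1.
  rewrite divr1 mulr1; apply: hp.
  by rewrite addrAC subrr add0r.
pose T := taylor_poly th c p.+2.
pose T' := taylor_poly (fun j => th j.+1) c p.+1.
pose h (y : R) := th 0%N (y + c) - T.[y].
pose h' (y : R) := th 1%N (y + c) - T'.[y].
have hd (y : R) : is_derive y 1 h (h' y).
  rewrite /h' /T' -taylor_poly_deriv.
  have -> : h = (fun y => th 0%N (y + c)) - (fun y => T.[y]) by [].
  apply: is_deriveB; last exact: is_derive_poly.
  by apply: is_derive_shiftR => x; exact: dth.
have h0 : h 0 = 0.
  rewrite /h add0r /T horner_poly big_ord_recl big1 ?addr0.
    by rewrite expr0 mulr1 divr1 subrr.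
  by move=> i _; rewrite /= exprS mul0r mulr0.
have [y yz hy] := is_derive_mvt 0 z hd.
rewrite !subr0 in yz hy.
have -> : th 0%N (c + z) - T.[z] = h' y * z.
  by rewrite -hy h0 subr0 /h [c + z]addrC.
rewrite normrM exprSr mulrA; apply: ler_wpM2r => //.
have e0 : 0 <= e by apply: le_trans (hp c _); rewrite // subrr normr0.
rewrite /h' [y + c]addrC; apply: le_trans (IH (fun j => th j.+1) y _ _) _.
- by move=> j jp; exact: dth.
- by move=> s sc; apply: hp; apply: le_trans yz.
- by apply: ler_wpM2l => //; rewrite lerXn2r// nnegrE.
Qed.

(** These are the coefficients of the [k]-th finite difference. They exist because the nodes
    [0, ..., k] are distinct, so their Vandermonde matrix is invertible. *)
Lemma difference_coefs k : exists al : 'I_k.+1 -> R, forall p, (p <= k)%N ->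
  \sum_q al q * q%:R ^+ p = if p == k then k`!%:R else 0.
Proof.
pose V := Vandermonde k.+1 (\row_(q < k.+1) (q%:R : R)).
have Vu : V \in unitmx.
  rewrite unitmxE unitfE det_Vandermonde.
  apply/prodf_neq0 => i _; apply/prodf_neq0 => j ij.
  by rewrite !mxE subr_eq0 eqr_nat gtn_eqF.
pose t : 'cV[R]_k.+1 := \col_p (if p == k :> nat then k`!%:R else 0).
exists (fun q => (invmx V *m t) q 0) => p pk.
have /matrixP/(_ (inord p) 0) : V *m (invmx V *m t) = t by rewrite mulKVmx.
rewrite !mxE inordK// => <-.
by apply: eq_bigr => q _; rewrite /V !mxE inordK// mulrC.
Qed.

Definition mono k j (t : R) := ((('X^k : {poly R})^`(j)).[t]).

Lemma monoE k j t : mono k j t = t ^+ (k - j) *+ k ^_ j.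
Proof. by rewrite /mono derivnXn hornerMn hornerXn. Qed.

Lemma mono_bounded k l A : exists2 B, 1 <= B &
  forall j t, (j <= l)%N -> `|t| <= A -> `|mono k j t| <= B.
Proof.
have [B B1 HB] := finite_norm_bound
  (fun j : 'I_l.+1 => (1 + `|A|) ^+ k *+ k ^_ j).
exists B => // j t jl tA.
apply: le_trans (HB (inord j)); rewrite inordK// monoE !normrMn lerMn2r.
rewrite normrX [X in _ <= X]ger0_norm ?exprn_ge0 ?addr_ge0//.
have h1 : 1 <= 1 + `|A| by rewrite lerDl.
apply/orP; right; apply: (@le_trans _ _ ((1 + `|A|) ^+ (k - j))).
  rewrite lerXn2r ?nnegrE ?addr_ge0//; apply: le_trans tA _.
  by apply: le_trans (ler_norm _) _; rewrite lerDr.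
by apply: ler_weXn2l => //; rewrite leq_subr.
Qed.

(* The k-th finite difference in the slope p.2, with step tending to 0. *)
Lemma monomial_approx m th k A e : chain m th -> 1 <= A -> 0 < e ->
  exists s : seq (R * R), forall j i t c, (k + i <= m)%N -> (j + i <= m)%N ->
    `|t| <= A -> `|c| <= A ->
    `|\sum_(p <- s) p.1 * (p.2 ^+ j * th (j + i)%N (p.2 * t + c))
      - mono k j t * th (k + i)%N c| <= e.
Proof.
move=> cth A1 e0.
have A0 : 0 < A by apply: lt_le_trans A1.
have [al Hal] := difference_coefs k.
have k1 : 1 <= k.+1%:R :> R by rewrite ler1n.
have [B B0 HB] := chain_bounded (k.+1%:R * A) cth.
pose L1 := \sum_q `|al q| * (k.+1%:R ^+ k * A ^+ k).
pose L2 := \sum_q `|al q| * (k.+1%:R ^+ m * B).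
have L10 : 0 <= L1.
  by apply: sumr_ge0 => q _; rewrite mulr_ge0// mulr_ge0// exprn_ge0// ltW.
have L20 : 0 <= L2.
  by apply: sumr_ge0 => q _; rewrite mulr_ge0// mulr_ge0// ?exprn_ge0// ltW.
have [e1 e10 He1] := small_bound L10 e0.
have [d1 d10 Hd1] := chain_unif_continuous A cth e10.
have [d2 d20 Hd2] := small_bound L20 e0.
(* The step of the difference quotient. The bound [d2] makes the surplus powers of [de] negligible
   when [j > k]; the last bound keeps every increment [q * de * t] below the modulus of continuity
   [d1]. *)
pose de := Num.min 1 (Num.min d2 (d1 / (2 * (k.+1%:R * A)))).
have kA0 : 0 < k.+1%:R * A by rewrite mulr_gt0// (lt_le_trans _ k1).
have de0 : 0 < de.
  by rewrite !lt_min ltr01 d20 divr_gt0// mulr_gt0.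
have de1 : de <= 1 by rewrite ge_min lexx.
have ded2 : de <= d2 by rewrite !ge_min lexx orbT.
have ded1 : k.+1%:R * A * de < d1.
  have : de <= d1 / (2 * (k.+1%:R * A)) by rewrite !ge_min lexx !orbT.
  rewrite ler_pdivlMr ?mulr_gt0//; lra.
have qk (q : 'I_k.+1) : q%:R <= k.+1%:R :> R by rewrite ler_nat ltnW.
have zle (q : 'I_k.+1) t : `|t| <= A -> `|q%:R * de * t| <= k.+1%:R * A * de.
  move=> tA; rewrite !normrM (gtr0_norm de0) normr_nat mulrAC.
  by apply: ler_wpM2r; [exact: ltW|apply: ler_pM].
(* The [k]-th difference quotient at slope 0: slopes [q * de], weights [al q] divided by the [k]-th
   power of the step. *)
exists [seq (al q * de ^- k, q%:R * de) | q <- enum 'I_k.+1] => j i t c kim jim tA cA.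
rewrite big_map big_enum/=.
(* For [j > k] the target is 0, being a derivative of [X^k] of order above [k], and each term
   retains a positive power of [de]. *)
have [jk|kj] := leqP j k; last first.
  rewrite monoE ffact_small// mulr0n mul0r subr0.
  apply: le_trans (ler_norm_sum _ _ _) _; apply: le_trans Hd2.
  rewrite mulr_suml; apply: ler_sum => q _.
  have jE : j = (k + (j - k).-1.+1)%N by rewrite prednK ?subn_gt0// subnKC// ltnW.
  rewrite !normrM !normrX normfV normrX normrM (gtr0_norm de0) exprMn normr_nat.
  rewrite -!mulrA; apply: ler_wpM2l => //.
  rewrite {2}jE exprD exprSr.
  have -> : de ^- k * (q%:R ^+ j * (de ^+ k * (de ^+ (j - k).-1 * de) *
     `|th (j + i)%N (q%:R * (de * t) + c)|)) =
     q%:R ^+ j * `|th (j + i)%N (q%:R * (de * t) + c)| * (de ^+ (j - k).-1 * de).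
    have : de ^+ k != 0 by rewrite expf_neq0// gt_eqF.
    by move=> ?; field.
  rewrite [leRHS]mulrA; apply: ler_pM.
  - by rewrite mulr_ge0// exprn_ge0.
  - by rewrite mulr_ge0// ?exprn_ge0// ltW.
  - apply: ler_pM; [by rewrite exprn_ge0|by []| |].
      apply: (@le_trans _ _ (k.+1%:R ^+ j)); first by rewrite lerXn2r// nnegrE.
      by apply: ler_weXn2l => //; apply: leq_trans jim; rewrite leq_addr.
    apply: HB => //; apply: le_trans (ler_normD _ _) _.
    rewrite mulrA; case: (q) => -[|q'] hq /=.
      rewrite !mul0r normr0 add0r; apply: le_trans cA _.
      by rewrite ler_peMl// ltW.
    apply: (@le_trans _ _ (k%:R * A + A)); last by rewrite -natr1 mulrDl mul1r.
    apply: lerD => //; rewrite !normrM normr_nat (gtr0_norm de0).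
    rewrite -mulrA; apply: ler_pM => //; first by rewrite mulr_ge0// ltW.
      by rewrite ler_nat.
    by rewrite -[A]mul1r ler_pM// ltW.
  - apply: le_trans ded2; rewrite ger_pMl// exprn_ile1// ltW//.
pose p := (k - j)%N.
have kE : k = (j + p)%N by rewrite /p subnKC.
pose thi r := th (j + i + r)%N.
pose T := taylor_poly thi c p.+1.
(* With [th (j + i)] replaced by its Taylor polynomial only moments of order [j + r <= k] occur. All
   vanish except the one of order [k], so the identity is exact. *)
have main : \sum_(q < k.+1) al q * de ^- k * ((q%:R * de) ^+ j * T.[q%:R * de * t])
    = mono k j t * th (k + i)%N c.
  have -> : \sum_(q < k.+1) al q * de ^- k * ((q%:R * de) ^+ j * T.[q%:R * de * t])
    = \sum_(r < p.+1) (thi r c / r`!%:R * t ^+ r * (de ^- k * de ^+ (j + r))) *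
       \sum_(q < k.+1) al q * q%:R ^+ (j + r).
    under [RHS]eq_bigr do rewrite mulr_sumr.
    rewrite exchange_big/=; apply: eq_bigr => q _.
    rewrite /T horner_poly !mulr_sumr; apply: eq_bigr => r _.
    by rewrite !exprMn !exprD; ring.
  rewrite big_ord_recr big1/= ?add0r; last first.
    move=> r _; rewrite Hal; last by rewrite kE leq_add2l ltnW.
    by rewrite ltn_eqF ?mulr0// kE ltn_add2l.
  rewrite -kE Hal// eqxx mulVf ?expf_neq0 ?gt_eqF// mulr1 monoE.
  have -> : thi p c = th (k + i)%N c by rewrite /thi addnAC -kE.
  rewrite -/p -(ffact_fact jk) -/p natrM -[RHS]mulrC -[in RHS]mulr_natr.
  have : p`!%:R != 0 :> R by rewrite pnatr_eq0 -lt0n fact_gt0.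
  by move=> ?; field.
rewrite -main -sumrB; apply: le_trans (ler_norm_sum _ _ _) _.
apply: le_trans He1; rewrite mulr_suml; apply: ler_sum => q _.
rewrite -!mulrBr !normrM !normrX normfV normrX normrM normr_nat (gtr0_norm de0) -!mulrA.
apply: ler_wpM2l => //.
have tb : `|th (j + i)%N (q%:R * (de * t) + c) - T.[q%:R * (de * t)]| <=
    e1 * `|q%:R * (de * t)| ^+ p.
  have -> : th (j + i)%N (q%:R * (de * t) + c) = thi 0%N (c + q%:R * (de * t)).
    by rewrite /thi addn0 addrC.
  apply: taylor_bound.
    move=> r rp s; rewrite /thi addnS; apply: cth.1.
    apply: leq_trans kim; rewrite kE addnAC ltn_add2r ltn_add2l.
    exact: rp.
  move=> y yc; rewrite /thi addnAC -kE distrC.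
  apply: Hd1 => //; rewrite distrC.
  by apply: le_lt_trans yc _; rewrite mulrA; apply: le_lt_trans (zle q t tA) ded1.
apply: (@le_trans _ _ (de ^- k * ((q%:R * de) ^+ j * (e1 * `|q%:R * (de * t)| ^+ p)))).
  apply: ler_wpM2l; first by rewrite invr_ge0 exprn_ge0// ltW.
  by apply: ler_wpM2l => //; rewrite exprn_ge0// mulr_ge0// ltW.
(* The powers of [de] cancel because [j + p = k]; what remains is the small oscillation [e1]. *)
have -> : de ^- k * ((q%:R * de) ^+ j * (e1 * `|q%:R * (de * t)| ^+ p)) =
   q%:R ^+ k * `|t| ^+ p * e1.
  have kX (x : R) : x ^+ k = x ^+ j * x ^+ p by rewrite -exprD -kE.
  rewrite !normrM (gtr0_norm de0) normr_nat !kX !exprMn.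
  have : de ^+ j != 0 by rewrite expf_neq0// gt_eqF.
  have : de ^+ p != 0 by rewrite expf_neq0// gt_eqF.
  by move=> ? ?; field; apply/andP.
rewrite mulrA; apply: ler_wpM2r; first exact: ltW.
apply: ler_pM; rewrite ?exprn_ge0//.
  by rewrite lerXn2r// nnegrE.
apply: (@le_trans _ _ (A ^+ p)); first by rewrite lerXn2r// nnegrE ltW.
by apply: ler_weXn2l => //; rewrite leq_subr.
Qed.

End taylor.

(** * Approximable families *)

Definition mdeg (n : nat) (a : 'I_n -> nat) : nat := (\sum_i a i)%N.

Lemma leq_mdeg (n : nat) (a : 'I_n -> nat) i : (a i <= mdeg a)%N.
Proof. by rewrite /mdeg (bigD1 i)//= leq_addr. Qed.

(* The argument a is the multi-index of the derivative being represented. *)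
Definition ridge (R : realType) (n : nat) (th : nat -> R -> R) (w : 'I_n -> R)
    (b : R) (a : 'I_n -> nat) (x : 'rV[R]_n) : R :=
  (\prod_i w i ^+ a i) * th (mdeg a) (\sum_i w i * x 0 i + b).

Definition tensor (R : realType) (n : nat) (u : 'I_n -> nat -> R -> R)
    (a : 'I_n -> nat) (x : 'rV[R]_n) : R := \prod_i u i (a i) (x 0 i).

Section approximable.
Context {R : realType} (n l : nat) (K : set 'rV[R]_n) (s0 : nat -> R -> R).
Implicit Types (F G : ('I_n -> nat) -> 'rV[R]_n -> R) (th : nat -> R -> R).

Definition jet_close e F G :=
  forall a x, (mdeg a <= l)%N -> K x -> `|F a x - G a x| <= e.

Definition net (s : seq (R * R * ('I_n -> R))) (a : 'I_n -> nat) x :=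
  \sum_(p <- s) p.1.1 * ridge s0 p.2 p.1.2 a x.

Definition approximable F := forall e, 0 < e -> exists s, jet_close e F (net s).

Lemma approximable_lim F :
  (forall e, 0 < e -> exists2 G, approximable G & jet_close e F G) -> approximable F.
Proof.
move=> H e e0; have e20 : 0 < e / 2 by rewrite divr_gt0.
have [G aG cG] := H _ e20; have [s cs] := aG _ e20.
exists s => a x al Kx; rewrite -[F a x](subrK (G a x)) -addrA.
apply: le_trans (ler_normD _ _) _.
by have := cG a x al Kx; have := cs a x al Kx; lra.
Qed.

Lemma approximable_ext F G : approximable G ->
  (forall a x, (mdeg a <= l)%N -> K x -> F a x = G a x) -> approximable F.
Proof.
move=> aG FG; apply: approximable_lim => e e0; exists G => // a x al Kx.
by rewrite FG// subrr normr0 ltW.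
Qed.

Lemma approximable_net s : approximable (net s).
Proof. by move=> e e0; exists s => a x _ _; rewrite subrr normr0 ltW. Qed.

Lemma approximable_scale c F : approximable F ->
  approximable (fun a x => c * F a x).
Proof.
move=> aF e e0; have [d d0 Hd] := small_bound (normr_ge0 c) e0.
have [s cs] := aF _ d0.
exists [seq (c * p.1.1, p.1.2, p.2) | p <- s] => a x al Kx.
have -> : net [seq (c * p.1.1, p.1.2, p.2) | p <- s] a x = c * net s a x.
  by rewrite /net big_map mulr_sumr; apply: eq_bigr => p _; rewrite mulrA.
rewrite -mulrBr normrM; apply: le_trans Hd.
by apply: ler_wpM2l => //; exact: cs.
Qed.

Lemma approximable_add F G : approximable F -> approximable G ->
  approximable (fun a x => F a x + G a x).
Proof.
move=> aF aG e e0; have e20 : 0 < e / 2 by rewrite divr_gt0.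
have [s cs] := aF _ e20; have [t ct] := aG _ e20.
exists (s ++ t) => a x al Kx.
have -> : net (s ++ t) a x = net s a x + net t a x by rewrite /net big_cat.
rewrite opprD addrACA; apply: le_trans (ler_normD _ _) _.
by have := cs a x al Kx; have := ct a x al Kx; lra.
Qed.

Lemma approximable_sum (I : Type) (r : seq I) (c : I -> R)
    (F : I -> ('I_n -> nat) -> 'rV[R]_n -> R) :
  (forall i, approximable (F i)) ->
  approximable (fun a x => \sum_(i <- r) c i * F i a x).
Proof.
move=> aF; elim: r => [|i r IH].
  apply: approximable_ext (approximable_net [::]) _ => a x _ _.
  by rewrite /net !big_nil.
apply: approximable_ext (approximable_add (approximable_scale (c i) (aF i)) IH) _.
by move=> a x _ _; rewrite big_cons.
Qed.

Variable A : R.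
Hypotheses (A1 : 1 <= A) (KA : forall x i, K x -> `|x 0 i| <= A).

Lemma affine_bounded (w : 'I_n -> R) b : exists2 D, 1 <= D &
  forall (P : pred 'I_n) x, K x -> `|\sum_(i | P i) w i * x 0 i + b| <= D.
Proof.
exists (1 + (\sum_i `|w i| * A + `|b|)).
  by rewrite lerDl addr_ge0// sumr_ge0// => i _; rewrite mulr_ge0// (le_trans _ A1).
move=> P x Kx; apply: (@le_trans _ _ (\sum_i `|w i| * A + `|b|)); last by rewrite lerDr.
apply: le_trans (ler_normD _ _) _; rewrite lerD2r.
apply: le_trans (ler_norm_sum _ _ _) _.
rewrite [leRHS](bigID P)/= -[leLHS]addr0 lerD//.
  by apply: ler_sum => i _; rewrite normrM ler_wpM2l// KA.
by apply: sumr_ge0 => i _; rewrite mulr_ge0// (le_trans _ A1).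
Qed.

(** A neuron of [th'] with bias [b] is the average of the neurons of [th] with biases in
    [[b, b + 1]]; a Riemann sum of mesh [1 / N] is a finite combination of these. *)
Lemma approximable_smooth m th th' : (l <= m)%N -> chain m th ->
  (forall w b, approximable (ridge th w b)) ->
  (forall j, (j <= m)%N -> exists2 H,
     (forall t : R, is_derive t 1 H (th j t)) & th' j = fdiff H) ->
  forall w b, approximable (ridge th' w b).
Proof.
move=> lm cth ath Hth' w b; apply: approximable_lim => e e0.
have [D D1 HD] := affine_bounded w b.
have [B B1 HB] := finite_norm_bound w.
have BB0 : 0 <= (B ^+ l) ^+ #|'I_n| by rewrite !exprn_ge0// (le_trans _ B1).
have [e1 e10 He1] := small_bound BB0 e0.
have [d d0 Hd] := chain_unif_continuous (D + 1) cth e10.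
pose N := (Num.truncn d^-1).+1.
have Nd : N%:R^-1 < d.
  by rewrite invf_plt ?posrE ?ltr0n// truncnS_gt.
exists (fun a x => \sum_(i <- enum 'I_N) N%:R^-1 * ridge th w (b + i%:R / N%:R) a x).
  exact: approximable_sum.
move=> a x al Kx; rewrite big_enum/=.
have -> : \sum_(i < N) N%:R^-1 * ridge th w (b + i%:R / N%:R) a x =
  (\prod_i w i ^+ a i) * \sum_(i < N) N%:R^-1 *
     th (mdeg a) (\sum_i w i * x 0 i + b + i%:R / N%:R).
  by rewrite mulr_sumr; apply: eq_bigr => i _; rewrite /ridge addrA mulrCA.
rewrite /ridge -mulrBr normrM; apply: le_trans He1; apply: ler_pM => //.
  apply: prod_norm_le; first exact: exprn_ege1.
  by move=> i _; apply: norm_exp_le => //; apply: leq_trans al; exact: leq_mdeg.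
have [H HH ->] := Hth' _ (leq_trans al lm).
apply: fdiff_riemann => // s s' sD ss'.
apply: Hd; [exact: leq_trans lm| |exact: le_lt_trans Nd].
by apply: le_trans sD _; rewrite lerD2r; exact: (HD xpredT).
Qed.

(** Interpolates between a ridge function ([L] empty) and a monomial times a constant ([L] full).
    Each coordinate in [L] has become a power of degree [k i] at the price of [k i] derivatives of
    [th]. *)
Definition mix th (k : 'I_n -> nat) (L : seq 'I_n) (w : 'I_n -> R) (b : R)
    (a : 'I_n -> nat) (x : 'rV[R]_n) : R :=
  (\prod_i if i \in L then mono (k i) (a i) (x 0 i) else w i ^+ a i) *
  th (\sum_i if i \in L then k i else a i)%N
     (\sum_(i | i \notin L) w i * x 0 i + b).

(* One coordinate at a time, the weight w i is sent to 0 in a difference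
   quotient of mdeg k i, which turns w i ^+ a i into a derivative of
   the k i-th power of the i-th coordinate. *)
Lemma approximable_mix m th k L w b : (l + \sum_i k i <= m)%N -> chain m th ->
  (forall w b, approximable (ridge th w b)) -> uniq L ->
  approximable (mix th k L w b).
Proof.
move=> lkm cth ath; elim: L w b => [|i0 L IH] w b.
  by move=> _; apply: approximable_ext (ath w b) _.
move=> /= /andP[i0L uL]; apply: approximable_lim => e e0.
have [D D1 HD] := affine_bounded w b.
have [B B1 HB] := finite_norm_bound w.
have [BM BM1 HBM] : exists2 BM, 1 <= BM & forall i j t, (j <= l)%N ->
    `|t| <= A -> `|mono (k i) j t| <= BM.
  have /choice[f Hf] : forall i, exists B : R, 1 <= B /\
      forall j t, (j <= l)%N -> `|t| <= A -> `|mono (k i) j t| <= B.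
    by move=> i; have [B0 ? ?] := mono_bounded (k i) l A; exists B0.
  have [B2 B21 HB2] := finite_norm_bound f.
  exists B2 => // i j t jl tA; apply: le_trans ((Hf i).2 j t jl tA) _.
  by apply: le_trans (ler_norm _) (HB2 i).
pose B3 := Num.max BM (B ^+ l).
have B31 : 1 <= B3 by rewrite le_max BM1.
have BB0 : 0 <= B3 ^+ #|'I_n| by rewrite exprn_ge0// (le_trans _ B31).
have [e1 e10 He1] := small_bound BB0 e0.
(* One bound for both the coordinate [x 0 i0] and the offset [c] formed by the remaining coordinates
   and the bias. *)
pose A' := Num.max A D.
have A'1 : 1 <= A' by rewrite le_max A1.
have [s Hs] := monomial_approx (k i0) cth A'1 e10.
pose wu (v : R) i := if i == i0 then v else w i.
exists (fun a x => \sum_(p <- s) p.1 * mix th k L (wu p.2) b a x).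
  by apply: approximable_sum => p; exact: IH.
move=> a x al Kx.
pose Y := \prod_(i | i != i0)
  (if i \in L then mono (k i) (a i) (x 0 i) else w i ^+ a i).
pose E := (\sum_(i | i != i0) if i \in L then k i else a i)%N.
pose c := \sum_(i | (i != i0) && (i \notin L)) w i * x 0 i + b.
have inL i : i != i0 -> (i \in i0 :: L) = (i \in L).
  by rewrite inE => /negbTE ->.
have -> : mix th k (i0 :: L) w b a x =
    Y * (mono (k i0) (a i0) (x 0 i0) * th (k i0 + E)%N c).
  rewrite /mix (bigD1 i0)//= mem_head [X in _ * X * _](_ : _ = Y); last first.
    by apply: eq_bigr => i /inL ->.
  rewrite mulrAC [LHS]mulrC.
  congr (_ * (_ * th _ (_ + _))).
    by rewrite (bigD1 i0)//= mem_head; congr addn; apply: eq_bigr => i /inL ->.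
  by apply: eq_bigl => i; rewrite inE negb_or.
have -> : \sum_(p <- s) p.1 * mix th k L (wu p.2) b a x =
    Y * \sum_(p <- s) p.1 * (p.2 ^+ a i0 * th (a i0 + E)%N (p.2 * x 0 i0 + c)).
  rewrite mulr_sumr; apply: eq_bigr => p _.
  rewrite /mix (bigD1 i0)//= (negbTE i0L) {1}/wu eqxx.
  rewrite [X in _ * X * _](_ : _ = Y); last first.
    by apply: eq_bigr => i ii0; rewrite /wu (negbTE ii0).
  rewrite [in th _ _](bigD1 i0)//= (negbTE i0L) -/E.
  rewrite [\sum_(i | i \notin L) _](bigD1 i0)//= {1}/wu eqxx -addrA.
  rewrite [X in _ + (X + b)](_ : _ = \sum_(i | (i != i0) && (i \notin L)) w i * x 0 i).
    by rewrite -/c; ring.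
  apply: eq_big => [i|i]; first by rewrite andbC.
  by case/andP => _ /negbTE h; rewrite /wu h.
rewrite -mulrBr normrM; apply: le_trans He1; apply: ler_pM => //.
  apply: prod_norm_le => // i ii0; rewrite le_max; case: ifP => _.
    by rewrite HBM ?KA// (leq_trans (leq_mdeg a i)).
  by rewrite norm_exp_le ?orbT// (leq_trans (leq_mdeg a i)).
have kaE (P : pred 'I_n) : (\sum_(i | P i) (if i \in L then k i else a i) <=
    \sum_(i | P i) (k i + a i))%N.
  by apply: leq_sum => i _; case: ifP => _; rewrite ?leq_addr ?leq_addl.
(* Every derivative of [th] that occurs has order at most the sum of all [a i + k i], so it stays
   within the chain. *)
have tot : (k i0 + a i0 + E <= m)%N.
  apply: leq_trans lkm; rewrite addnC.
  apply: leq_trans (leq_add al (leqnn _)).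
  rewrite /mdeg [X in (_ <= X)%N]addnC -big_split/= [X in (_ <= X)%N](bigD1 i0)//=.
  by rewrite addnC leq_add2l; exact: kaE.
rewrite distrC; apply: Hs.
- by apply: leq_trans tot; rewrite leq_add2r leq_addr.
- by apply: leq_trans tot; rewrite leq_add2r leq_addl.
- by rewrite le_max KA.
- by rewrite le_max HD ?orbT.
Qed.

(** Once all coordinates are converted, the only trace of [th] is the constant [th (\sum_i k i) b];
    a bias where it is nonzero allows division. *)
Lemma approximable_mono m th k : (l + \sum_i k i <= m)%N -> chain m th ->
  (forall w b, approximable (ridge th w b)) -> (exists t, th m t != 0) ->
  approximable (tensor (fun i => mono (k i))).
Proof.
move=> lkm cth ath th0.
have [b b0] : exists b, th (\sum_i k i)%N b != 0.
  by apply: chain_nonzero cth _ th0; apply: leq_trans lkm; rewrite leq_addl.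
have := approximable_mix (fun=> 0) b lkm cth ath (enum_uniq 'I_n).
move=> /(approximable_scale (th (\sum_i k i)%N b)^-1).
move/approximable_ext; apply => a x _ _.
rewrite /mix [X in _ * (_ * th X _)](_ : _ = \sum_i k i)%N; last first.
  by apply: eq_bigr => i _; rewrite mem_enum.
rewrite [X in _ * (_ * th _ (X + _))]big1 ?add0r; last first.
  by move=> i; rewrite mem_enum.
rewrite mulrCA mulVf// mulr1 /tensor; apply: eq_bigr => i _.
by rewrite mem_enum.
Qed.

Lemma approximable_monomials k : chain l s0 ->
  dominated_primitive (s0 l) -> (exists t, s0 l t != 0) ->
  approximable (tensor (fun i => mono (k i))).
Proof.
move=> cs0 ds0 ns0.
have H q : exists th, [/\ chain (l + q) th,
    forall w b, approximable (ridge th w b),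
    dominated_primitive (th (l + q)%N) & exists t, th (l + q)%N t != 0].
  elim: q => [|q [th [cth ath dth nth]]].
    exists s0; rewrite addn0; split => // w b.
    apply: approximable_ext (approximable_net [:: (1, b, w)]) _ => a x _ _.
    by rewrite /net big_seq1 mul1r.
  have [th' [cth' e Hth']] := chain_smooth cth.
  exists th'; rewrite addnS; split => //.
  - exact: approximable_smooth (leq_addr _ _) cth ath Hth'.
  - by rewrite e; exact: dominated_primitive_fdiff.
  - rewrite e; apply: contrapT => hn.
    (* Were the new top derivative identically 0, the old one would have period 1 and hence
       vanish. *)
    have /(dominated_primitive_periodic (cth.2 _ (leqnn _)) dth) h0 t :
        fdiff (th (l + q)%N) t = 0.
      by apply/eqP/contraT => ?; exfalso; apply: hn; exists t.
    by case: nth => t; rewrite h0 eqxx.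
have [th [cth ath _ nth]] := H (\sum_i k i)%N.
exact: approximable_mono cth ath nth.
Qed.

End approximable.

(** * Polynomial approximation of truncated powers *)

Section polynomial_approximation.
Context {R : realType}.
Implicit Types (p q : {poly R}) (u v : nat -> R -> R).

(** The classical iteration replacing [P] by [P + (t^2 - P^2) / 2], which increases to [|t|] on
    [[-1, 1]]. *)
Lemma norm_poly_approx (e : R) : 0 < e ->
  exists p, forall t, `|t| <= 1 -> `| `|t| - p.[t]| <= e.
Proof.
move=> e0.
pose P := fix P k : {poly R} := if k is k'.+1 then
  P k' + 2^-1 *: ('X ^+ 2 - P k' ^+ 2) else 0.
(* The last bound makes the error less than [2 / k] uniformly in [t] for [k > 0]. It persists
   because each iteration multiplies the error by [1 - (|t| + P) / 2], at most [1 - |t| / 2]. *)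
have HP k t : `|t| <= 1 -> [/\ 0 <= (P k).[t], (P k).[t] <= `|t| &
    (`|t| - (P k).[t]) * (1 + k%:R * (`|t| / 2)) <= `|t|].
  move=> t1; elim: k => [|k [h1 h2 h3]].
    by rewrite /= horner0 mul0r addr0 mulr1 subr0.
  have -> : (P k.+1).[t] = (P k).[t] + 2^-1 * (`|t| ^+ 2 - (P k).[t] ^+ 2).
    by rewrite /= !hornerE real_normK ?num_real.
  move: h1 h2 h3; set q := (P k).[t]; set a := `|t| in t1 *.
  have a0 : 0 <= a by rewrite normr_ge0.
  move=> h1 h2 h3; have k0 : 0 <= k%:R :> R by [].
  split.
  - nra.
  - nra.
  - rewrite -[k.+1%:R]natr1.
    have -> : a - (q + 2^-1 * (a ^+ 2 - q ^+ 2)) = (a - q) * (1 - (a + q) / 2).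
      by field.
    apply: le_trans h3; rewrite -mulrA; apply: ler_wpM2l; first by rewrite subr_ge0.
    move: (k%:R) k0 => c c0.
    apply: (@le_trans _ _ ((1 - a / 2) * (1 + (c + 1) * (a / 2)))).
      apply: ler_wpM2r; last by lra.
      by rewrite addr_ge0// mulr_ge0// ?divr_ge0// addr_ge0.
    have -> : (1 - a / 2) * (1 + (c + 1) * (a / 2)) =
      1 + c * (a / 2) - (c + 1) * (a / 2) ^+ 2 by ring.
    by rewrite gerBl mulr_ge0 ?exprn_ge0 ?divr_ge0 ?addr_ge0.
pose k := (Num.truncn (2 / e)).+1.
have ke : 2 < k%:R * e by rewrite -ltr_pdivrMr// truncnS_gt.
exists (P k) => t t1; have [h1 h2 h3] := HP k t t1.
rewrite ger0_norm ?subr_ge0//.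
have [t0|tn0] := eqVneq `|t| 0; first by move: h1 h2; rewrite t0; lra.
have tp : 0 < `|t| by rewrite lt_neqAle eq_sym tn0 /=.
rewrite leNgt; apply/negP => he.
have : (`|t| - (P k).[t]) * (k%:R * (`|t| / 2)) <= `|t|.
  apply: le_trans h3; apply: ler_wpM2l; first by rewrite subr_ge0.
  by rewrite lerDr.
have : e * (k%:R * (`|t| / 2)) < (`|t| - (P k).[t]) * (k%:R * (`|t| / 2)).
  by rewrite ltr_pM2r// !mulr_gt0// ?ltr0n// invr_gt0.
have : 2 * (`|t| / 2) < k%:R * e * (`|t| / 2) by rewrite ltr_pM2r// divr_gt0.
have -> : e * (k%:R * (`|t| / 2)) = k%:R * e * (`|t| / 2) by ring.
lra.
Qed.

(** Normalised by the factorial so that [tpow d] is the derivative of [tpow d.+1] away from 0. For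
    [d = 0] it is the unit step with value 1 at 0. *)
Definition tpow d (t : R) : R := if 0 <= t then t ^+ d / d`!%:R else 0.

Definition poly_primitive p : {poly R} :=
  \poly_(i < (size p).+1) (p`_i.-1 / i%:R).

Lemma poly_primitiveK p : deriv (poly_primitive p) = p.
Proof.
apply/polyP => i; rewrite coef_deriv coef_poly ltnS.
case: ltnP => [ip|pi]; last by rewrite mul0rn nth_default.
by rewrite -[LHS]mulr_natr divfK ?pnatr_eq0.
Qed.

Lemma poly_primitive0 p : (poly_primitive p).[0] = 0.
Proof. by rewrite horner_coef0 coef_poly /= invr0 mulr0. Qed.

Lemma poly_increment p (a b e : R) : a <= b ->
  (forall t, a <= t <= b -> `|(deriv p).[t]| <= e) ->
  `|p.[b] - p.[a]| <= e * (b - a).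
Proof.
move=> ab H.
have [c|c] := @MVT_segment R (horner p) (horner (deriv p)) a b ab
  (fun x _ => is_derive_poly p x).
  by apply: continuous_subspaceT => x; exact: continuous_horner.
rewrite in_itv/= => cab ->; rewrite normrM [X in _ * X]ger0_norm ?subr_ge0//.
by apply: ler_wpM2r; [rewrite subr_ge0|exact: H].
Qed.

(** Induction on [l]: the primitive vanishing at 0 of a polynomial for order [l] serves for the next
    order. Its derivatives are covered by the induction hypothesis and its values by integration
    from 0. The exponents [l.+1 - k] stay at least 1. *)
Lemma tpow_approx l (A e : R) : 0 <= A -> 0 < e -> exists p,
  forall k t, (k <= l)%N -> `|t| <= A -> `|tpow (l.+1 - k) t - (derivn k p).[t]| <= e.
Proof.
move=> A0; elim: l e => [|l IH] e e0.
  have A10 : 0 < A + 1 by lra.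
  have [e1 e10 He1] := small_bound (ltW A10) e0.
  have [p Hp] := norm_poly_approx e10.
  (* The positive part of [t] is [(t + |t|) / 2]. The factor [A + 1] rescales [[-A, A]] into
     [[-1, 1]] and is positive even for [A = 0]. *)
  exists (2^-1 *: ('X + (A + 1) *: (p \Po ((A + 1)^-1 *: 'X)))) => k t.
  rewrite leqn0 => /eqP -> tA; rewrite subn0 /=.
  rewrite !hornerE horner_comp !hornerE.
  have tt : `|t / (A + 1)| <= 1.
    rewrite normrM normfV (gtr0_norm A10) ler_pdivrMr// mul1r; lra.
  have -> : tpow 1 t = 2^-1 * (t + (A + 1) * `|t / (A + 1)|).
    rewrite normrM normfV (gtr0_norm A10) mulrCA divff ?gt_eqF// mulr1 /tpow.
    case: ifPn => t0; first by rewrite ger0_norm// expr1 divr1; lra.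
    by rewrite ltr0_norm ?ltNge//; lra.
  have := Hp _ tt; rewrite [_^-1 * t]mulrC => Hp'.
  rewrite -mulrBr opprD addrACA subrr add0r -mulrBr normrM.
  rewrite [X in _ * X]normrM (gtr0_norm A10) [X in X * _]gtr0_norm//.
  have : (A + 1) * `| `|t / (A + 1)| - p.[t / (A + 1)]| <= e.
    by apply: le_trans He1; apply: ler_wpM2l => //; exact: ltW.
  have : 0 <= (A + 1) * `| `|t / (A + 1)| - p.[t / (A + 1)]|.
    by rewrite mulr_ge0// ltW.
  lra.
have [e1 e10 He1] := small_bound A0 e0.
have mn0 : 0 < Num.min e e1 by rewrite lt_min e0.
have [p Hp] := IH _ mn0.
exists (poly_primitive p) => -[|k] t kl tA; last first.
  rewrite derivSn poly_primitiveK subSS.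
  by have := Hp k t kl tA; rewrite le_min => /andP[].
have Hp0 s : `|s| <= A -> `|tpow l.+1 s - p.[s]| <= e1.
  by move=> sA; have := Hp 0%N s (leq0n _) sA; rewrite le_min subn0 => /andP[].
rewrite subn0 derivn0 /tpow; case: ifPn => t0.
  rewrite ger0_norm// in tA.
  (* For [t >= 0] the truncated power is a genuine power, so the error is a polynomial whose
     derivative is small. For [t < 0] the primitive itself is the error. *)
  have := @poly_increment (poly_primitive p - l.+2`!%:R^-1 *: 'X^(l.+2)) 0 t e1 t0.
  rewrite subr0 => H; rewrite distrC.
  apply: (@le_trans _ _ (e1 * t)); last first.
    by apply: le_trans He1; rewrite mulrC; apply: ler_wpM2r => //; exact: ltW.
  apply: le_trans (H _).
    rewrite !hornerD !hornerN !hornerZ !hornerXn poly_primitive0 expr0n mulr0.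
    by rewrite !subr0 [_^-1 * _]mulrC.
  move=> s /andP[s0 st].
  have := Hp0 s; rewrite ger0_norm// => /(_ (le_trans st tA)).
  rewrite derivB poly_primitiveK derivZ derivXn hornerD hornerN hornerZ hornerMn hornerXn distrC.
  rewrite /tpow s0 (_ : s ^+ l.+1 / l.+1`!%:R = l.+2`!%:R^-1 * (s ^+ l.+1 *+ l.+2))//.
  rewrite [l.+2`!]factS natrM invfM -[s ^+ _ *+ _]mulr_natl mulrACA.
  by rewrite mulVf ?pnatr_eq0// mul1r mulrC.
rewrite -ltNge in t0; rewrite ltr0_norm// in tA.
have := @poly_increment (poly_primitive p) t 0 e1 (ltW t0).
rewrite poly_primitive0 !sub0r !normrN => H.
apply: le_trans (H _) _.
  move=> s /andP[ts s0]; rewrite poly_primitiveK.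
  have := Hp0 s; rewrite ler0_norm// => /(_ _)/le_trans.
  have -> : tpow l.+1 s = 0.
    rewrite /tpow; case: ifP => // s0'.
    have -> : s = 0 by apply/eqP; rewrite eq_le s0.
    by rewrite expr0n mul0r.
  by rewrite sub0r normrN; apply=> //; lra.
by apply: le_trans He1; rewrite mulrC; apply: ler_wpM2r => //; exact: ltW.
Qed.

Variable l : nat.

Definition poly_approximable u := forall B e : R, 0 < e -> exists p,
  forall k t, (k <= l)%N -> `|t| <= B -> `|u k t - (derivn k p).[t]| <= e.

Lemma poly_approximable_mono k : poly_approximable (mono k).
Proof.
by move=> B e e0; exists 'X^k => j t _ _; rewrite /mono subrr normr0 ltW.
Qed.

Lemma poly_approximable_tpow : poly_approximable (fun k => tpow (l.+1 - k)).
Proof.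
move=> B e e0; have [p Hp] := tpow_approx l (normr_ge0 B) e0.
exists p => k t kl tB; apply: Hp => //; apply: le_trans tB _; exact: ler_norm.
Qed.

Lemma poly_approximable_sub u v : poly_approximable u -> poly_approximable v ->
  poly_approximable (fun k t => u k t - v k t).
Proof.
move=> Hu Hv B e e0; have e20 : 0 < e / 2 by rewrite divr_gt0.
have [p Hp] := Hu B _ e20; have [q Hq] := Hv B _ e20.
exists (p - q) => k t kl tB; rewrite derivnB hornerD hornerN.
have -> : u k t - v k t - ((derivn k p).[t] - (derivn k q).[t]) =
  u k t - (derivn k p).[t] - (v k t - (derivn k q).[t]) by ring.
apply: le_trans (ler_normB _ _) _.
by have := Hp k t kl tB; have := Hq k t kl tB; lra.
Qed.

Lemma derivn_comp_affine p (c d : R) k :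
  derivn k (p \Po (c *: 'X + d%:P)) = c ^+ k *: (derivn k p \Po (c *: 'X + d%:P)).
Proof.
elim: k => [|k IH]; first by rewrite !derivn0 expr0 scale1r.
rewrite !derivnS IH derivZ deriv_comp derivD derivC derivZ derivX addr0.
by rewrite alg_polyC mulrC mul_polyC scalerA exprSr.
Qed.

Lemma poly_approximable_affine u (c d : R) : poly_approximable u ->
  poly_approximable (fun k t => c ^+ k * u k (c * t + d)).
Proof.
move=> Hu B e e0.
have C1 : 1 <= 1 + `|c| by rewrite lerDl.
have [e1 e10 He1] := small_bound (exprn_ge0 l (le_trans ler01 C1)) e0.
have [p Hp] := Hu (`|c| * B + `|d|) _ e10.
exists (p \Po (c *: 'X + d%:P)) => k t kl tB.
rewrite derivn_comp_affine hornerZ horner_comp !hornerE -mulrBr normrM.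
apply: le_trans He1; apply: ler_pM => //.
  by apply: norm_exp_le => //; rewrite lerDr.
apply: Hp => //; apply: le_trans (ler_normD _ _) _.
by rewrite normrM lerD2r ler_wpM2l.
Qed.

Lemma poly_approximable_bounded u (A : R) : poly_approximable u ->
  exists B : R, 1 <= B /\ forall k t, (k <= l)%N -> `|t| <= A -> `|u k t| <= B.
Proof.
move=> /(_ A _ ltr01)[p Hp].
pose b (k : 'I_l.+1) : R := \sum_(i < size (derivn k p)) `|(derivn k p)`_i| * `|A| ^+ i.
have [B B1 HB] := finite_norm_bound b.
exists (B + 1); split; first by lra.
move=> k t kl tA; rewrite -[u k t](subrK (derivn k p).[t]).
apply: le_trans (ler_normD _ _) _; rewrite addrC lerD ?Hp//.
apply: le_trans (HB (inord k)); apply: le_trans (ler_norm _).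
rewrite /b inordK// horner_coef; apply: le_trans (ler_norm_sum _ _ _) _.
apply: ler_sum => i _; rewrite normrM normrX ler_wpM2l// lerXn2r ?nnegrE//.
by apply: le_trans tA _; exact: ler_norm.
Qed.

End polynomial_approximation.

(** * Tensor products of functions approximable by polynomials *)

Section tensor_closure.
Context {R : realType} (n l : nat) (K : set 'rV[R]_n) (s0 : nat -> R -> R).
Variable A : R.
Hypothesis KA : forall x i, K x -> `|x 0 i| <= A.

Lemma derivn_horner_mono (p : {poly R}) j t :
  (derivn j p).[t] = \sum_(k < size p) p`_k * mono k j t.
Proof.
rewrite -{1}[p]coefK poly_def linear_sum horner_sum; apply: eq_bigr => k _.
by rewrite /= linearZ hornerZ.
Qed.

(** Factors are replaced by polynomials one coordinate at a time, and a polynomial factor expands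
    into monomials. The list [L] holds the coordinates whose factor is not yet known to be a
    monomial. *)
Lemma approximable_tensor :
  (forall k, approximable l K s0 (tensor (fun i : 'I_n => mono (k i)))) ->
  forall u, (forall i, poly_approximable l (u i)) ->
  approximable l K s0 (tensor u).
Proof.
move=> Hmono u Hu.
suff H (L : seq 'I_n) : forall u, (forall i, poly_approximable l (u i)) ->
    (forall i, i \notin L -> exists k, u i = mono k) ->
    approximable l K s0 (tensor u).
  by apply: (H (enum 'I_n)) => // i; rewrite mem_enum.
elim: L => [|i0 L IH] {Hu}u Hu HL.
  have /choice[k Hk] : forall i, exists k, u i = mono k by move=> i; exact: HL.
  suff -> : u = fun i => mono (k i) by [].
  by apply/funext => i; rewrite Hk.
apply: approximable_lim => e e0.
have /choice[f Hf] := fun i => poly_approximable_bounded A (Hu i).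
have [B B1 HB] := finite_norm_bound f.
have BB0 : 0 <= B ^+ #|'I_n| by rewrite exprn_ge0// (le_trans _ B1).
have [e1 e10 He1] := small_bound BB0 e0.
have [p Hp] := Hu i0 A _ e10.
pose uu v i := if i == i0 then v else u i.
exists (fun a x => \sum_(k <- enum 'I_(size p)) p`_k * tensor (uu (mono k)) a x).
  apply: approximable_sum => k; apply: IH => i.
    by rewrite /uu; case: eqP => // _; exact: poly_approximable_mono.
  move=> iL; rewrite /uu; case: eqP => [_|/eqP ii0]; first by exists k.
  by apply: HL; rewrite inE negb_or ii0.
move=> a x al Kx.
pose Y := \prod_(i | i != i0) u i (a i) (x 0 i).
have tE v : tensor (uu v) a x = Y * v (a i0) (x 0 i0).
  rewrite /tensor (bigD1 i0)//= {1}/uu eqxx mulrC; congr (_ * _).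
  by apply: eq_bigr => i ii0; rewrite /uu (negbTE ii0).
have -> : tensor u a x = Y * u i0 (a i0) (x 0 i0).
  by rewrite /tensor (bigD1 i0)//= mulrC.
rewrite big_enum/=.
have -> : \sum_(k < size p) p`_k * tensor (uu (mono k)) a x =
    Y * (derivn (a i0) p).[x 0 i0].
  rewrite derivn_horner_mono mulr_sumr; apply: eq_bigr => k _.
  by rewrite tE mulrCA.
rewrite -mulrBr normrM; apply: le_trans He1; apply: ler_pM => //.
  apply: prod_norm_le => // i _; apply: le_trans (HB i); apply: le_trans (ler_norm _).
  by apply: (Hf i).2; [exact: leq_trans (leq_mdeg a i) al|exact: KA].
by apply: Hp; [exact: leq_trans (leq_mdeg a i0) al|exact: KA].
Qed.

End tensor_closure.

(** * B-splines and nested sums *)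

Definition bdiff (R : realType) (u : R -> R) (t : R) := u t - u (t - 1).

Section splines.
Context {R : realType}.
Implicit Types (u v : R -> R) (t : R).

Lemma iter_bdiff_scale m u c t :
  iter m (@bdiff R) (fun t => c * u t) t = c * iter m (@bdiff R) u t.
Proof. by elim: m t => [//|m IH] t; rewrite !iterS /bdiff !IH mulrBr. Qed.

(** The Leibniz rule for iterated differences with one linear factor, the source of the B-spline
    recurrence. *)
Lemma iter_bdiff_mulX m u t :
  iter m.+1 (@bdiff R) (fun t => t * u t) t =
  t * iter m.+1 (@bdiff R) u t + m.+1%:R * iter m (@bdiff R) u (t - 1).
Proof.
elim: m t => [|m IH] t; first by rewrite /= /bdiff; ring.
rewrite iterS {1}/bdiff !IH.
have -> : iter m.+2 (@bdiff R) u t = iter m.+1 (@bdiff R) u t -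
  iter m.+1 (@bdiff R) u (t - 1) by [].
have -> : iter m.+1 (@bdiff R) u (t - 1) = iter m (@bdiff R) u (t - 1) -
  iter m (@bdiff R) u (t - 1 - 1) by [].
by rewrite -[m.+2%:R]natr1; ring.
Qed.

Lemma mulX_tpow d t : t * tpow d t = d.+1%:R * tpow d.+1 t.
Proof.
rewrite /tpow; case: ifP => _; last by rewrite !mulr0.
rewrite factS natrM invfM exprS [RHS]mulrCA mulVKf ?pnatr_eq0//.
by rewrite mulrA.
Qed.

(** The cardinal B-spline of degree [d] with knots [0, ..., d + 1]. *)
Definition spline d := iter d.+1 (@bdiff R) (tpow d).

(** One difference fewer: it passes from 0 to 1 on [[0, d]], and its backward difference is the
    B-spline. *)
Definition spline_step d := iter d (@bdiff R) (tpow d).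

Lemma tpow_recurrence d m t : d.+1%:R * iter m.+1 (@bdiff R) (tpow d.+1) t =
  t * iter m.+1 (@bdiff R) (tpow d) t + m.+1%:R * iter m (@bdiff R) (tpow d) (t - 1).
Proof.
rewrite -iter_bdiff_scale -iter_bdiff_mulX.
by congr (iter _ _ _ _); apply/funext => s; rewrite mulX_tpow.
Qed.

Lemma iter_bdiff_supp m u (T t : R) : (forall t, T <= t -> u t = 0) ->
  T + m%:R <= t -> iter m (@bdiff R) u t = 0.
Proof.
move=> Hu; elim: m t => [|m IH] t; first by rewrite addr0; exact: Hu.
by rewrite -[m.+1%:R]natr1 => ht; rewrite iterS /bdiff !IH ?subrr//; lra.
Qed.

Lemma iter_bdiff_neg m u t : (forall t, t < 0 -> u t = 0) -> t < 0 ->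
  iter m (@bdiff R) u t = 0.
Proof.
move=> Hu; elim: m t => [|m IH] t ht; first exact: Hu.
by rewrite iterS /bdiff !IH ?subrr//; lra.
Qed.

Lemma tpow_neg d t : t < 0 -> tpow d t = 0.
Proof. by rewrite /tpow ltNge => /negbTE ->. Qed.

Lemma spline_neg d t : t < 0 -> spline d t = 0.
Proof. by apply: iter_bdiff_neg; exact: tpow_neg. Qed.

Lemma spline_step_neg d t : t < 0 -> spline_step d t = 0.
Proof. by apply: iter_bdiff_neg; exact: tpow_neg. Qed.

(** In the recurrence the term with factor [t] is a difference of two values equal to 1, so only the
    previous step function remains. *)
Lemma spline_step1 d t : d%:R <= t -> spline_step d t = 1.
Proof.
elim: d t => [|d IH] t dt.
  by rewrite /spline_step /= /tpow dt expr0 divr1.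
rewrite -[d.+1%:R]natr1 in dt.
have := tpow_recurrence d d t; rewrite -/(spline_step d.+1 t) -/(spline_step d (t - 1)).
rewrite iterS {1}/bdiff -/(spline_step d t) -/(spline_step d (t - 1)) !IH; [|lra|lra].
by rewrite subrr mulr0 add0r; apply: mulfI; rewrite pnatr_eq0.
Qed.

Lemma spline_supp d t : d.+1%:R <= t -> spline d t = 0.
Proof.
rewrite -natr1 => dt; rewrite /spline iterS /bdiff -/(spline_step d t).
by rewrite -/(spline_step d (t - 1)) !spline_step1 ?subrr//; lra.
Qed.

(** The recurrence expresses the next spline through the weights [t] and [d + 2 - t], both
    nonnegative on its support. *)
Lemma spline_ge0 d t : 0 <= spline d t.
Proof.
elim: d t => [|d IH] t.
  rewrite /spline /= /bdiff /tpow !expr0 divr1.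
  by case: ifPn => h1; case: ifPn => h2; lra.
have [t0|t0] := ltP t 0; first by rewrite spline_neg.
have [td|td] := leP d.+2%:R t; first by rewrite spline_supp.
have d0 : 0 < d.+1%:R :> R by rewrite ltr0n.
rewrite -(pmulr_rge0 _ d0) tpow_recurrence -/(spline d (t - 1)).
rewrite iterS {1}/bdiff -/(spline d t) -/(spline d (t - 1)).
have -> : t * (spline d t - spline d (t - 1)) + d.+2%:R * spline d (t - 1) =
  t * spline d t + (d.+2%:R - t) * spline d (t - 1) by ring.
by rewrite addr_ge0// mulr_ge0// subr_ge0 ltW.
Qed.

(** The sum of translates telescopes to a difference of two step values, one already 1 and the other
    still 0. *)
Lemma spline_partition d (N : nat) t : d%:R <= t -> t < N%:R ->
  \sum_(j < N) spline d (t - j%:R) = 1.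
Proof.
move=> dt tN.
rewrite -(big_mkord xpredT (fun j => spline d (t - j%:R))).
have -> : \sum_(0 <= j < N) spline d (t - j%:R) =
   \sum_(0 <= j < N) (- spline_step d (t - j.+1%:R) - - spline_step d (t - j%:R)).
  apply: eq_bigr => j _; rewrite /spline iterS /bdiff.
  rewrite -/(spline_step d (t - j%:R)) -/(spline_step d (t - j%:R - 1)).
  by rewrite opprK addrC -[j.+1%:R]natr1 opprD addrA.
rewrite telescope_sumr// subr0 (spline_step1 dt) spline_step_neg; last by lra.
by rewrite oppr0 sub0r opprK.
Qed.

Lemma poly_approximable_spline l m :
  poly_approximable l (fun k => iter m (@bdiff R) (tpow (l.+1 - k))).
Proof.
elim: m => [|m IH]; first exact: poly_approximable_tpow.
have := poly_approximable_sub IH (poly_approximable_affine 1 (-1) IH).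
congr poly_approximable; apply/funext => k; apply/funext => t.
by rewrite expr1n !mul1r.
Qed.

End splines.

Section nested_sums.
Context {R : realType} (n N : nat).
Implicit Types (M : 'I_n -> R -> R) (g : ('I_n -> R) -> R) (y t : 'I_n -> R).

Definition upd y i v : 'I_n -> R := fun i' => if i' == i then v else y i'.

(** An iterated sum over the grid indices of the coordinates in [L], weighted by a product of
    kernels; [y] records the indices chosen so far. *)
Fixpoint nested M g (L : seq 'I_n) y t : R :=
  if L is i :: L' then
    \sum_(j < N) M i (t i - j%:R) * nested M g L' (upd y i j%:R) t
  else g y.

Lemma eq_nested M M' g L y t : {in L, M =1 M'} ->
  nested M g L y t = nested M' g L y t.
Proof.
elim: L y => [//|i L IH] y H /=; apply: eq_bigr => j _.
by rewrite H ?mem_head// IH// => i' i'L; rewrite H// inE i'L orbT.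
Qed.

Lemma nested_sub M g1 g2 L y t :
  nested M (fun y => g1 y - g2 y) L y t = nested M g1 L y t - nested M g2 L y t.
Proof.
elim: L y => [//|i L IH] y /=; rewrite -sumrB; apply: eq_bigr => j _.
by rewrite IH mulrBr.
Qed.

Lemma nested_scale M g c L y t :
  nested M (fun y => c * g y) L y t = c * nested M g L y t.
Proof.
elim: L y => [//|i L IH] y /=; rewrite mulr_sumr; apply: eq_bigr => j _.
by rewrite IH mulrCA.
Qed.

Lemma nested_scale_kernel M (c : 'I_n -> R) g L y t :
  nested (fun i s => c i * M i s) g L y t =
  (\prod_(i <- L) c i) * nested M g L y t.
Proof.
elim: L y => [|i L IH] y /=; first by rewrite big_nil mul1r.
rewrite big_cons mulr_sumr; apply: eq_bigr => j _.
by rewrite IH; ring.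
Qed.

Definition bshift i y := upd y i (y i - 1).

Lemma nested_shift M g L y t i : i \notin L ->
  nested M (fun y => g (bshift i y)) L y t = nested M g L (bshift i y) t.
Proof.
elim: L y => [//|i' L IH] y /=; rewrite inE negb_or => /andP[ii' iL].
apply: eq_bigr => j _; rewrite IH//; congr (_ * nested _ _ _ _ _).
apply/funext => k; rewrite /bshift /upd (negbTE ii').
by case: (eqVneq k i') => // ->; rewrite eq_sym (negbTE ii').
Qed.

(** The two hypotheses kill the boundary terms at the ends of the index range. *)
Lemma sum_by_parts (u phi : R -> R) (s : R) : u s = 0 -> u (s - N%:R) = 0 ->
  \sum_(j < N) bdiff u (s - j%:R) * phi j%:R =
  \sum_(j < N) u (s - j%:R) * (phi j%:R - phi (j%:R - 1)).
Proof.
move=> u0 uN; apply/eqP; rewrite -subr_eq0 -sumrB; apply/eqP.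
pose w (j : nat) := - (u (s - j%:R) * phi (j%:R - 1)).
transitivity (w N - w 0%N); last by rewrite /w uN subr0 u0 !mul0r subrr.
rewrite -(telescope_sumr w (leq0n N)) big_mkord; apply: eq_bigr => j _.
rewrite /w /bdiff -[j.+1%:R]natr1 addrK opprD addrA; ring.
Qed.

Lemma nested_by_parts M u g L y t i : uniq L -> i \in L ->
  M i =1 bdiff u -> u (t i) = 0 -> u (t i - N%:R) = 0 ->
  nested M g L y t =
  nested (fun i' => if i' == i then u else M i') (fun y => g y - g (bshift i y)) L y t.
Proof.
move=> + + Mi u0 uN; elim: L y => [//|i' L IH] y /= /andP[i'L uL]; rewrite inE.
have [ei _|ii' /= iL] := eqVneq i i'; last first.
  by apply: eq_bigr => j _; rewrite IH.
subst i'; rewrite ?eqxx.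
pose phi v := nested M g L (upd y i v) t.
have -> : \sum_(j < N) M i (t i - j%:R) * nested M g L (upd y i j%:R) t =
    \sum_(j < N) bdiff u (t i - j%:R) * phi j%:R.
  by apply: eq_bigr => j _; rewrite Mi.
rewrite sum_by_parts//; apply: eq_bigr => j _; congr (_ * _).
rewrite -(@eq_nested M); last first.
  by move=> k kL; case: eqP kL => // ->; rewrite (negbTE i'L).
rewrite nested_sub nested_shift//; congr (_ - nested _ _ _ _ _).
by apply/funext => k; rewrite /bshift /upd eqxx; case: eqP.
Qed.

Fixpoint bdiffs (s : seq 'I_n) g : ('I_n -> R) -> R :=
  if s is i :: s' then bdiffs s' (fun y => g y - g (bshift i y)) else g.

(** Moves the differences from the kernels onto the data, one entry of [s] at a time. Each summation
    by parts needs a partially differenced kernel to vanish at both ends, hence the condition for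
    every [c] below the multiplicity. *)
Lemma nested_bdiffs M s g L y t : uniq L -> (forall i, i \in L) ->
  (forall i c, (c < count_mem i s)%N -> iter c (@bdiff R) (M i) (t i) = 0 /\
     iter c (@bdiff R) (M i) (t i - N%:R) = 0) ->
  nested (fun i => iter (count_mem i s) (@bdiff R) (M i)) g L y t =
  nested M (bdiffs s g) L y t.
Proof.
move=> uL HL; elim: s g => [|i s IH] g Hc; first exact: eq_nested.
have [v1 v2] : iter (count_mem i s) (@bdiff R) (M i) (t i) = 0 /\
     iter (count_mem i s) (@bdiff R) (M i) (t i - N%:R) = 0.
  by apply: Hc; rewrite /= eqxx.
rewrite (nested_by_parts _ _ uL (HL i) _ v1 v2)/=; last by rewrite eqxx add1n.
rewrite -IH; last by move=> i' c hc; apply: Hc => /=; exact: leq_trans (leq_addl _ _).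
apply: eq_nested => i' _; case: (eqVneq i' i) => [->//|ii'].
by rewrite ?(eq_sym i) ?(negbTE ii').
Qed.

(** With nonnegative kernels of total mass 1 the sum is a convex combination of values of [g], and
    only indices within [D] of [t] carry weight. *)
Lemma nested_close M g L y t c e D : uniq L ->
  (forall i s, 0 <= M i s) ->
  (forall i s, M i s != 0 -> 0 <= s <= D) ->
  (forall i, \sum_(j < N) M i (t i - j%:R) = 1) ->
  (forall y', (forall i, i \in L -> `|y' i - t i| <= D) ->
     (forall i, i \notin L -> y' i = y i) -> `|g y' - c| <= e) ->
  `|nested M g L y t - c| <= e.
Proof.
move=> + M0 MD M1; elim: L y => [|i L IH] y /= uL Hg; first exact: Hg.
case/andP: uL => iL uL.
have ME x : x = \sum_(j < N) M i (t i - j%:R) * x by rewrite -mulr_suml M1 mul1r.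
rewrite [X in _ - X]ME -sumrB; apply: le_trans (ler_norm_sum _ _ _) _.
rewrite [leRHS]ME; apply: ler_sum => j _.
rewrite -mulrBr normrM ger0_norm//.
have [->|/MD/andP[h1 h2]] := eqVneq (M i (t i - j%:R)) 0; first by rewrite !mul0r.
apply: ler_wpM2l => //; apply: IH => // y' H1 H2; apply: Hg => i'; rewrite inE.
  case: (eqVneq i' i) => [->{i'} _|_ /= h]; last exact: H1.
  by rewrite H2// /upd eqxx distrC ger0_norm.
rewrite negb_or => /andP[ii' i'L].
by rewrite H2// /upd (negbTE ii').
Qed.

End nested_sums.

(** Expanding the sum yields finitely many tensor products of rescaled translates of the [u i]; the
    factor [h ^+ a i] is the one from the chain rule. *)
Lemma approximable_nested (R : realType) (n l N : nat) (K : set 'rV[R]_n) s0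
    (u : 'I_n -> nat -> R -> R) (g : ('I_n -> R) -> R) (c : 'I_n -> R) (h : R) y :
  (forall u, (forall i, poly_approximable l (u i)) ->
    approximable l K s0 (@tensor R n u)) ->
  (forall i, poly_approximable l (u i)) ->
  approximable l K s0 (fun a x => nested N (fun i s => h ^+ a i * u i (a i) s) g
    (enum 'I_n) y (fun i => h * x 0 i + c i)).
Proof.
move=> Ht Hu.
suff H (L : seq 'I_n) (v : 'I_n -> nat -> R -> R) : uniq L ->
    (forall i, poly_approximable l (v i)) -> forall y,
    approximable l K s0 (fun a x => (\prod_(i | i \notin L) v i (a i) (x 0 i)) *
      nested N (fun i s => h ^+ a i * u i (a i) s) g L y (fun i => h * x 0 i + c i)).
  apply: approximable_ext (H _ _ (enum_uniq 'I_n) Hu y) _ => a x _ _.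
  by rewrite big1 ?mul1r// => i; rewrite mem_enum.
elim: L v => [|i L IH] v /= => [_ Hv y'|/andP[iL uL] Hv y'].
  by apply: approximable_ext (approximable_scale (g y') (Ht v Hv)) _ => a x _ _;
    rewrite mulrC.
(* Once the index of coordinate [i] is fixed, its kernel depends on [x 0 i] alone and joins the
   outer product. *)
pose vv (j : 'I_N) i' := if i' == i then
  (fun k s => h ^+ k * u i k (h * s + (c i - j%:R))) else v i'.
have Hvv j i' : poly_approximable l (vv j i').
  by rewrite /vv; case: (i' == i) => //; exact: poly_approximable_affine.
have := approximable_sum (enum 'I_N) (fun=> 1)
  (fun j : 'I_N => IH (vv j) uL (Hvv j) (upd y' i j%:R)).
move/approximable_ext; apply.
move=> a x _ _; rewrite big_enum mulr_sumr /=; apply: eq_bigr => j _.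
rewrite mul1r [in RHS](bigD1 i)//= {1}/vv eqxx.
rewrite mulrA [X in X * nested _ _ _ _ _ _ = _]mulrC addrA.
congr (_ * _ * _); apply: eq_big => [i'|i' h']; first by rewrite inE negb_or andbC.
by move: h'; rewrite inE negb_or /vv => /andP[/negbTE ->].
Qed.

(** * Spline approximation of smooth functions *)

Section row_vectors.
Context {R : realType} (n : nat).
Implicit Types (x y z v : 'rV[R]_n) (F : 'rV[R]_n -> R).

Lemma norm_coord_le x i : `|x 0 i| <= `|x|.
Proof.
rewrite [leRHS]mx_normrE.
exact: (le_bigmax _ (fun k : 'I_1 * 'I_n => `|x k.1 k.2|) (0, i)).
Qed.

Lemma norm_rV_le x c : 0 <= c -> (forall i, `|x 0 i| <= c) -> `|x| <= c.
Proof.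
move=> c0 H; have [e|/mx_norm_neq0[[i j] /= e]] := eqVneq (mx_norm x) 0.
  by rewrite [leLHS]e.
by rewrite [leLHS]e [i]ord1.
Qed.

Lemma norm_evec_le (i : 'I_n) : `|evec R i| <= 1.
Proof.
apply: norm_rV_le => // j; rewrite mxE eqxx /=.
by case: (j == i); rewrite ?normr0 ?normr1.
Qed.

Lemma is_derive_line F z v (t : R) d : is_derive (z + t *: v) v F d ->
  is_derive t 1 (fun t : R => F (z + t *: v)) d.
Proof.
move=> [H1 H2].
have e : (fun h : R => h^-1 *: (((fun t : R => F (z + t *: v)) \o shift t) (h *: 1)
     - F (z + t *: v))) =
   (fun h : R => h^-1 *: ((F \o shift (z + t *: v)) (h *: v) - F (z + t *: v))).
  apply/funext => h /=; congr (_ *: (F _ - _)).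
  by rewrite scalerDl [h *: 1]mulr1 addrCA.
split; first by rewrite /derivable e.
by rewrite /derive e.
Qed.

Lemma line_mvt F (dF : 'rV[R]_n -> R) z v h : 0 <= h ->
  (forall t, 0 <= t <= h -> is_derive (z + t *: v) v F (dF (z + t *: v))) ->
  exists2 t, 0 <= t <= h & F (z + h *: v) - F z = h * dF (z + t *: v).
Proof.
move=> h0 H.
have Hd t : 0 <= t <= h ->
    is_derive t 1 (fun t : R => F (z + t *: v)) (dF (z + t *: v)).
  by move=> /H; exact: is_derive_line.
have [t ht||t] := @MVT_segment R (fun t => F (z + t *: v))
    (fun t => dF (z + t *: v)) 0 h h0.
- by apply: Hd; move: ht; rewrite in_itv/= => /andP[/ltW -> /ltW ->].
- apply: derivable_within_continuous => t; rewrite in_itv/= => /Hd ht.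
  by case: ht.
- rewrite in_itv/= => th; rewrite scale0r addr0 subr0 mulrC => e.
  by exists t.
Qed.

Fixpoint dxs (h : R) (s : seq 'I_n) F : 'rV[R]_n -> R :=
  if s is i :: s' then dxs h s' (fun x => F x - F (x - h *: evec R i)) else F.

(** A mixed difference is a mixed derivative at a nearby point, times a power of the step. A whole
    family [phi] is carried so that the induction can replace it by its difference in one
    direction. *)
Lemma dxs_mvt s l (phi : seq 'I_n -> 'rV[R]_n -> R) x r h : 0 <= h ->
  (size s <= l)%N -> (size s)%:R * h <= r ->
  (forall s' i y, (size s' < l)%N -> `|y - x| <= r ->
     is_derive y (evec R i) (phi s') (phi (i :: s') y)) ->
  exists2 xi, `|xi - x| <= (size s)%:R * h &
    dxs h s (phi [::]) x = h ^+ size s * phi s xi.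
Proof.
move=> h0; elim: s phi r => [|i s IH] phi r /= sl sr Hphi.
  by exists x; rewrite ?subrr ?normr0 ?mul0r// expr0 mul1r.
rewrite -[(size s).+1%:R]natr1 mulrDl mul1r in sr *.
pose phi' s' x := phi s' x - phi s' (x - h *: evec R i).
have he : `|h *: evec R i| <= h.
  by rewrite normrZ ger0_norm// ler_piMr// norm_evec_le.
have [|||xi hxi e] := IH phi' (r - h).
- exact: ltnW.
- by rewrite lerBrDr.
- move=> s' i' y s'l yx.
  have -> : phi' s' = phi s' - (phi s' \o shift (- (h *: evec R i))) by [].
  apply: is_deriveB.
    by apply: Hphi => //; apply: le_trans yx _; rewrite gerBl.
  have hd : is_derive (y - h *: evec R i) (evec R i') (phi s')
      (phi (i' :: s') (y - h *: evec R i)).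
    apply: Hphi => //; rewrite addrAC.
    apply: le_trans (ler_normB _ _) _; rewrite -[r](subrK h).
    exact: lerD.
  case: hd => H1 H2.
  have ee : (fun k : R => k^-1 *: (((phi s' \o shift (- (h *: evec R i))) \o shift y)
       (k *: evec R i') - (phi s' \o shift (- (h *: evec R i))) y)) =
    (fun k : R => k^-1 *: ((phi s' \o shift (y - h *: evec R i)) (k *: evec R i')
       - phi s' (y - h *: evec R i))).
    by apply/funext => k /=; rewrite addrA.
  split; first by rewrite /derivable ee.
  by rewrite /derive ee.
have xie t : xi - h *: evec R i + t *: evec R i - x = xi - x + (t - h) *: evec R i.
  by rewrite scalerBl [t *: _ - _]addrC addrA [xi - x - _]addrAC addrAC.
have [t /andP[t0 th] et] : exists2 t, 0 <= t <= h &
    phi s (xi - h *: evec R i + h *: evec R i) - phi s (xi - h *: evec R i) =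
    h * phi (i :: s) (xi - h *: evec R i + t *: evec R i).
  apply: line_mvt => // t /andP[t0 th]; apply: Hphi => //.
  rewrite xie.
  apply: le_trans (ler_normD _ _) _; apply: le_trans sr; apply: lerD => //.
  rewrite normrZ; apply: (@le_trans _ _ (h * 1)); last by rewrite mulr1.
  apply: ler_pM => //; last exact: norm_evec_le.
  by rewrite ler_norml; apply/andP; split; lra.
exists (xi - h *: evec R i + t *: evec R i).
  rewrite xie.
  apply: le_trans (ler_normD _ _) _; apply: lerD => //.
  rewrite normrZ; apply: (@le_trans _ _ (h * 1)); last by rewrite mulr1.
  apply: ler_pM => //; last exact: norm_evec_le.
  by rewrite ler_norml; apply/andP; split; lra.
by rewrite -/(phi' [::]) e /phi' exprSr -mulrA -et subrK.
Qed.

(** The listing of a multi-index used in [pdm], for exponents without a fixed bound. *)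
Definition idx (a : 'I_n -> nat) : seq 'I_n :=
  flatten [seq nseq (a i) i | i <- enum 'I_n].

Lemma size_idx a : size (idx a) = mdeg a.
Proof.
rewrite /idx size_flatten /shape -map_comp sumnE big_map big_enum/=.
by apply: eq_bigr => i _; rewrite /= size_nseq.
Qed.

Lemma count_idx a i : count_mem i (idx a) = a i.
Proof.
rewrite /idx count_flatten -map_comp sumnE big_map big_enum/= (bigD1 i)//=.
rewrite count_nseq /= eqxx mul1n big1 ?addn0// => j ji.
by rewrite count_nseq /= (negbTE ji).
Qed.

End row_vectors.

(** A common lower bound for finitely many positive radii, obtained as the inverse of an upper bound
    for their inverses. *)
Lemma finite_pos_bound (R : realType) (I : finType) (P : I -> R -> Prop) :
  (forall i, exists2 d, 0 < d & P i d) ->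
  (forall i d d', d' <= d -> P i d -> P i d') ->
  exists2 d, 0 < d & forall i, P i d.
Proof.
move=> H mono_P; have /choice[f Hf] : forall i, exists d, 0 < d /\ P i d.
  by move=> i; have [d ? ?] := H i; exists d.
have [B B1 HB] := finite_norm_bound (fun i => (f i)^-1).
have B0 : 0 < B by apply: lt_le_trans B1.
exists B^-1; first by rewrite invr_gt0.
move=> i; have [f0 Pf] := Hf i; apply: mono_P Pf.
have := HB i; rewrite gtr0_norm ?invr_gt0// => h.
by rewrite -[f i]invrK lef_pV2// ?posrE ?invr_gt0.
Qed.

Lemma multi_index_finite (n l : nat) (P : ('I_n -> nat) -> Prop) :
  (forall a : {ffun 'I_n -> 'I_l.+1}, (mdeg (fun i => a i : nat) <= l)%N ->
    P (fun i => a i : nat)) ->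
  forall a, (mdeg a <= l)%N -> P a.
Proof.
move=> H a al.
have e : a = (fun i => [ffun i => inord (a i) : 'I_l.+1] i : nat).
  apply/funext => i; rewrite ffunE inordK// ltnS.
  exact: leq_trans (leq_mdeg a i) al.
by rewrite e; apply: H; rewrite -e.
Qed.

(** The indicator of [U] is continuous at the points of [K]; its uniform continuity with tolerance 1
    forces neighbours into [U]. *)
Lemma compact_open_nbhd (R : realType) (V : normedModType R) (K U : set V) :
  compact K -> open U -> K `<=` U ->
  exists2 d : R, 0 < d & forall x y, K x -> `|x - y| < d -> U y.
Proof.
move=> cK oU KU; pose g (x : V) : R := \1_U x.
have [x Kx|d d0 H] := @compact_unif_continuous R V K g 1 cK _ ltr01.
  apply/cvgrPdist_lt => e e0.
  have : \forall y \near x, U y by apply: open_nbhs_nbhs; split => //; exact: KU.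
  apply: filterS => y Uy; rewrite /g !indicE !mem_set//; last exact: KU.
  by rewrite subrr normr0.
exists d => // x y Kx xy; have := H x y Kx xy; rewrite /g !indicE.
rewrite (mem_set (KU _ Kx)); case: (asboolP (U y)) => // Uy.
by rewrite memNset// subr0 normr1 ltxx.
Qed.

Section smooth_functions.
Context {R : realType} (n l : nat) (K U : set 'rV[R]_n) (s0 : nat -> R -> R).
Variables (A : R) (f : 'rV[R]_n -> R).
Hypotheses (cK : compact K) (oU : open U) (KU : K `<=` U) (fU : Cl_on U l f).
Hypothesis KA : forall x i, K x -> `|x 0 i| <= A.
Hypothesis Htensor : forall u, (forall i, poly_approximable l (u i)) ->
    approximable l K s0 (@tensor R n u).

Lemma pds_unif_continuous e : 0 < e -> exists2 d : R, 0 < d &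
  forall x y, K x -> `|x - y| < d -> U y /\ forall a, (mdeg a <= l)%N ->
    `|pds (idx a) f x - pds (idx a) f y| <= e.
Proof.
move=> e0; have [d1 d10 H1] := compact_open_nbhd cK oU KU.
have [||d2 d20 H2] := @finite_pos_bound R {ffun 'I_n -> 'I_l.+1}
  (fun a d => (mdeg (fun i => a i : nat) <= l)%N ->
     forall x y, K x -> `|x - y| < d ->
     `|pds (idx (fun i => a i : nat)) f x - pds (idx (fun i => a i : nat)) f y| <= e).
- move=> a; have [al|al] := leqP (mdeg (fun i => a i : nat)) l; last by exists 1.
  have [x Kx|d d0 H] := @compact_unif_continuous R _ K
      (pds (idx (fun i => a i : nat)) f) e cK _ e0.
    by apply: fU.2; [rewrite size_idx|exact: KU].
  by exists d => // _ x y Kx xy; apply/ltW/H.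
- move=> a d d' dd' H al x y Kx xy; apply: H => //; exact: lt_le_trans dd'.
exists (Num.min d1 d2); first by rewrite lt_min d10.
move=> x y Kx; rewrite lt_min => /andP[xy1 xy2]; split; first exact: H1 xy1.
apply: multi_index_finite => a al; exact: H2.
Qed.

Lemma approximable_smooth_function : approximable l K s0 (fun a => pds (idx a) f).
Proof.
apply: approximable_lim => e e0.
have [r r0 Hr] := pds_unif_continuous e0.
(* Degree [l + 1] leaves degree at least 1 after [l] derivatives. All points used lie within
   [d.+1 + l] grid steps of [x]: the support of a spline plus the reach of the differences. *)
pose d := l.+1; pose D : nat := (d.+1 + l).+1.
have D0 : 0 < D%:R :> R by rewrite ltr0n.
pose h : R := r / 2 / D%:R.
have h0 : 0 < h by rewrite !divr_gt0.
have hV0 : 0 < h^-1 by rewrite invr_gt0.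
(* The index shift [T] makes the rescaled coordinates of [K] lie between [d + 1] and [N = 2 T], away
   from the ends of the index range. *)
pose T := (Num.truncn (`|A| / h + d.+2%:R)).+1.
have hT : `|A| / h + d.+2%:R < T%:R by rewrite truncnS_gt.
pose N := (T + T)%N.
pose pt (y : 'I_n -> R) : 'rV[R]_n := \row_i (h * (y i - T%:R)).
pose g y := f (pt y).
pose ker k := iter d.+1 (@bdiff R) (tpow (d - k)).
(* The quasi-interpolant together with its formal derivatives, [ker k] being the [k]-th derivative
   of the spline of degree [d]. The initial index vector is irrelevant since all coordinates are
   summed. *)
exists (fun a x => nested N (fun i s => h^-1 ^+ a i * ker (a i) s) g
    (enum 'I_n) (fun=> 0) (fun i => h^-1 * x 0 i + T%:R)).
  apply: (approximable_nested N (u := fun=> ker) g (fun=> T%:R) h^-1 (fun=> 0) Htensor).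
  by move=> i; exact: poly_approximable_spline.
move=> a x al Kx; rewrite distrC.
pose t i := h^-1 * x 0 i + T%:R; rewrite -/t.
have tb i : d.+1%:R < t i /\ t i < N%:R.
  have : `|h^-1 * x 0 i| <= `|A| / h.
    rewrite normrM (gtr0_norm hV0) mulrC ler_pM2r//.
    by apply: le_trans (KA i Kx) _; exact: ler_norm.
  rewrite ler_norml => /andP[h1 h2]; rewrite /t /N natrD.
  move: hT; rewrite -[d.+2%:R]natr1 => hT.
  have : 0 <= d.+1%:R :> R by [].
  by split; lra.
pose s := idx a; have as_ i : count_mem i s = a i by rewrite count_idx.
have ad i : (a i <= d)%N.
  by apply: leq_trans (leqnSn _); exact: leq_trans (leq_mdeg a i) al.
(* The [a i]-th derivative of the spline of degree [d] is the [a i]-th difference of the spline of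
   degree [d - a i]; these differences are then moved onto [f]. *)
pose M i := @spline R (d - a i)%N.
rewrite nested_scale_kernel big_enum/= prodrXr -/(mdeg a).
rewrite (@eq_nested _ _ _ _ (fun i => iter (count_mem i s) (@bdiff R) (M i))); last first.
  move=> i _; rewrite as_ /M /spline /ker -iterD.
  by rewrite addnS subnKC.
rewrite nested_bdiffs ?enum_uniq//; last 2 first.
- by move=> i; rewrite mem_enum.
- move=> i c; rewrite as_ => ca; have [t1 t2] := tb i; split.
    apply: (@iter_bdiff_supp _ _ _ (d - a i).+1%:R).
      by move=> v; exact: spline_supp.
    apply: le_trans (ltW t1); rewrite -natrD ler_nat addSn ltnS.
    by rewrite -leq_subRL ?leq_subr// subKn// ltnW.
  apply: iter_bdiff_neg; last by rewrite subr_lt0.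
  by move=> v; exact: spline_neg.
rewrite -nested_scale.
apply: (@nested_close _ _ _ _ _ _ _ _ _ _ d.+1%:R); first exact: enum_uniq.
- by move=> i v; exact: spline_ge0.
- move=> i v v0; apply/andP; split.
    by rewrite leNgt; apply: contra v0 => v0; rewrite /M spline_neg.
  rewrite leNgt; apply: contra v0 => v0; rewrite /M spline_supp//.
  by apply: le_trans (ltW v0); rewrite ler_nat ltnS leq_subr.
- move=> i; have [t1 t2] := tb i; apply: spline_partition => //.
  by apply: le_trans (ltW t1); rewrite ler_nat (leq_trans (leq_subr _ _)).
move=> y Hy _.
have bE s' F : bdiffs s' (fun y => F (pt y)) y = dxs h s' F (pt y).
  elim: s' F => [//|i s' IH] F /=; rewrite -(IH (fun x => F x - F (x - h *: evec R i))).
  congr bdiffs; apply/funext => y'; congr (_ - F _).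
  apply/rowP => j; rewrite !mxE eqxx /bshift /upd /=.
  by case: (eqVneq j i) => [->|_]; rewrite /= ?mulr1n ?mulr0n; ring.
rewrite /g bE.
have pty : `|pt y - x| <= d.+1%:R * h.
  apply: norm_rV_le => [|i]; first by rewrite mulr_ge0// ltW.
  rewrite !mxE; have := Hy i; rewrite mem_enum => /(_ isT) Hyi.
  have -> : h * (y i - T%:R) - x 0 i = (y i - t i) * h.
    by rewrite /t; field; rewrite gt_eqF.
  by rewrite normrM (gtr0_norm h0) ler_pM2r.
have Dh : (d.+1 + l)%:R * h < r.
  rewrite /h mulrA ltr_pdivrMr// mulrC.
  have : (d.+1 + l)%:R <= D%:R :> R by rewrite ler_nat leqnSn.
  move=> ?; apply: (@le_lt_trans _ _ (r / 2 * D%:R)).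
    by rewrite ler_pM2l// divr_gt0.
  by rewrite ltr_pM2r// ltr_pdivrMr//; lra.
have in_r z : `|z - pt y| <= l%:R * h -> `|x - z| < r.
  move=> hz; rewrite distrC; apply: le_lt_trans Dh.
  have -> : z - x = (z - pt y) + (pt y - x) by rewrite addrA subrK.
  by apply: le_trans (ler_normD _ _) _; rewrite natrD mulrDl addrC lerD.
have sl : (size s <= l)%N by rewrite size_idx.
have sh : (size s)%:R * h <= l%:R * h by rewrite ler_pM2r// ler_nat.
(* The divided difference of [f] at a grid point near [x] is its derivative at some [xi] still
   within [r] of [x]. *)
have [|xi hxi exi] := dxs_mvt (phi := fun s => pds s f) (x := pt y) (ltW h0) sl sh.
  move=> s' i z s'l hz; have [Uz _] := Hr x z Kx (in_r z hz).
  by split => //; apply: fU.1.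
rewrite [dxs _ _ _ _]exi size_idx exprVn mulKf ?expf_neq0 ?gt_eqF// distrC.
have [_ H] := Hr x xi Kx (in_r xi (le_trans hxi sh)).
exact: H.
Qed.

End smooth_functions.

(** * Hitting open sets *)

Section hitting.
Context {R : realType} (d : measure_display) (Omega : measurableType d)
  (P : probability Omega R) (m : nat) (X : nat -> Omega -> 'rV[R]_m).

Lemma eventually_small (I : finType) (q : I -> R) e : 0 < e ->
  (forall i, 0 <= q i < 1) -> exists2 N, (0 < N)%N & forall i, q i ^+ N <= e.
Proof.
move=> e0 q01.
have /choice[f Hf] : forall i, exists N, forall k, (N <= k)%N -> q i ^+ k <= e.
  move=> i; have /andP[q0 q1] := q01 i.
  have qn : `|q i| < 1 by rewrite ger0_norm.
  have /cvgrPdist_le/(_ _ e0)[N _ HN] := cvg_expr qn.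
  exists N => k Nk; have := HN k Nk; rewrite /= sub0r normrN ger0_norm//.
  exact: exprn_ge0.
exists (\max_i f i).+1 => // i; apply: Hf; apply: leqW.
exact: leq_bigmax.
Qed.

(** All of the first [N] samples miss [O p] with probability [q p ^+ N], where [q p < 1] by full
    support. A union bound over the [M] sets concludes. *)
Lemma hit_all_open (M : nat) (O : nat -> set 'rV[R]_m) (alpha : R) :
  iid_full_support P X -> (forall p, open (O p)) -> (forall p, O p !=set0) ->
  alpha < 1 -> exists2 N, (0 < N)%N & exists E, [/\ measurable E,
    (alpha%:E < P E)%E & forall w, E w -> forall p, (p < M)%N ->
      exists2 j, (j < N)%N & O p (X j w)].
Proof.
move=> [mX [indep [ident full]]] oO nO alpha1.
have bO p : borelV (O p) by apply: sub_sigma_algebra; exact: oO.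
have bOC p : borelV (~` O p) by rewrite -setTD; exact: sigma_algebraCD (bO p).
pose q p := fine (P (X 0%N @^-1` (~` O p))).
have qE p : P (X 0%N @^-1` (~` O p)) = (q p)%:E.
  by rewrite /q fineK// fin_num_measure//; exact: mX (bOC p).
have q01 p : 0 <= q p < 1.
  rewrite -!lee_fin -lte_fin -qE measure_ge0 /=.
  rewrite preimage_setC probability_setC; last exact: mX (bO p).
  have := full 0%N _ (oO p) (nO p).
  have : P (X 0%N @^-1` O p) \is a fin_num.
    by rewrite fin_num_measure//; apply: mX (bO p).
  case: (P _) => //= r _; rewrite lte_fin -EFinB lte_fin => r0; lra.
pose F N p := \bigcap_(j in [set` iota 0 N]) (X j @^-1` (~` O p)).
have PF N p : P (F N p) = (q p ^+ N)%:E.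
  rewrite /F (indep (iota 0 N) (fun=> ~` O p))//; last exact: iota_uniq.
  rewrite (eq_bigr (fun=> (q p)%:E)); last by move=> j _; rewrite ident.
  rewrite -{2}(size_iota 0 N); elim: (iota 0 N) => [|j s IH]; first by rewrite big_nil.
  by rewrite big_cons IH -EFinM -exprS.
have mF N p : measurable (F N p).
  by apply: bigcap_measurableType => j _; apply: mX (bOC p).
(* With [M.+1] in the denominator, [M] such terms add up to strictly less than [1 - alpha], also for
   [M = 0]. *)
have e0 : 0 < (1 - alpha) / M.+1%:R by rewrite divr_gt0// subr_gt0.
have [N N0 HN] := eventually_small e0 (fun p : 'I_M => q01 p).
exists N => //; pose G := \big[setU/set0]_(p < M) F N p.
have mG : measurable G by apply: bigsetU_measurable.
have PG : (P G <= (\sum_(p < M) q p ^+ N)%:E)%E.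
  apply: le_trans (Boole_inequality _ _) _ => //.
  rewrite -sumEFin; apply: lee_sum => p _.
  by rewrite le_eqVlt; apply/orP; left; apply/eqP; exact: PF.
exists (~` G); split; first exact: measurableC.
  rewrite probability_setC//.
  have : P G \is a fin_num by rewrite fin_num_measure.
  move: PG; case: (P G) => //= r; rewrite lee_fin => rs _.
  rewrite -EFinB lte_fin.
  have : \sum_(p < M) q p ^+ N <= \sum_(p < M) (1 - alpha) / M.+1%:R.
    by apply: ler_sum => p _; exact: HN.
  rewrite sumr_const card_ord -[leRHS]mulr_natr => rs'.
  have : (1 - alpha) / M.+1%:R * M%:R < 1 - alpha.
    rewrite mulrAC ltr_pdivrMr// ltr_pM2l ?subr_gt0// ltr_nat//.
  by move=> /(le_lt_trans rs')/(le_lt_trans rs); rewrite ltrBrDl ltrBrDr addrC.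
move=> w nG p pM; apply: contrapT => hn; apply: nG.
rewrite /G -bigcup_mkord; exists p => //= j; rewrite /= mem_iota add0n => /andP[_ jN] Oj.
by apply: hn; exists j.
Qed.

End hitting.

(** * Derivatives of networks and conclusion *)

Section network_derivatives.
Context {R : realType} (n : nat).
Implicit Types (x v : 'rV[R]_n) (U : set 'rV[R]_n).

Lemma is_derive_from_line (F : 'rV[R]_n -> R) x v d :
  is_derive (0 : R) 1 (fun t : R => F (x + t *: v)) d -> is_derive x v F d.
Proof.
move=> [H1 H2].
have e : (fun h : R => h^-1 *: ((F \o shift x) (h *: v) - F x)) =
   (fun h : R => h^-1 *: (((fun t : R => F (x + t *: v)) \o shift 0) (h *: 1)
     - F (x + 0 *: v))).
  apply/funext => h /=.
  by rewrite addr0 [h *: 1]mulr1 scale0r addr0 [x + _]addrC.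
split; first by rewrite /derivable e.
by rewrite /derive e.
Qed.

Lemma is_derive_ridge (th dth : R -> R) (w : 'I_n -> R) b c i x :
  (forall t : R, is_derive t 1 th (dth t)) ->
  is_derive x (evec R i) (fun x => c * th (\sum_k w k * x 0 k + b))
    (c * w i * dth (\sum_k w k * x 0 k + b)).
Proof.
move=> Hth; apply: is_derive_from_line.
set z := \sum_k w k * x 0 k + b.
have -> : (fun t : R => c * th (\sum_k w k * (x + t *: evec R i) 0 k + b)) =
    (fun=> c) * (th \o (fun t : R => t * w i + z)).
  apply/funext => t; congr (_ * th _); rewrite /z addrA; congr (_ + _).
  have -> : t * w i = \sum_k w k * (t * (k == i)%:R).
    rewrite (bigD1 i)//= eqxx mulr1 mulrC big1 ?addr0// => k /negbTE ->.
    by rewrite !mulr0.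
  rewrite -big_split/=; apply: eq_bigr => k _.
  by rewrite !mxE eqxx -mulrDr addrC.
have d1 : is_derive (0 : R) 1 (fun t : R => t * w i + z) (w i).
  have -> : (fun t : R => t * w i + z) = (w i *: (id : R -> R)) + cst z.
    by apply/funext => t; rewrite !fctE /= /GRing.scale/= mulrC.
  have := is_deriveD (is_deriveZ (w i) (is_derive_id (0 : R) 1)) (is_derive_cst z (0 : R) 1).
  by rewrite addr0 /GRing.scale/= mulr1.
have d2 : is_derive (0 : R) 1 (th \o (fun t : R => t * w i + z)) (dth z * w i).
  apply: is_derive1_comp; rewrite /= mul0r add0r; exact: Hth.
have -> : c * w i * dth z = c *: (dth z * w i) by rewrite /GRing.scale/=; ring.
exact: is_deriveZ.
Qed.

(** Differentiation is local: on the open set [U] the iterated derivative agrees with the candidate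
    near [x], so both have the same next derivative. *)
Lemma pds_jet U l (phi : seq 'I_n -> 'rV[R]_n -> R) : open U ->
  (forall s i x, (size s < l)%N -> U x ->
     is_derive x (evec R i) (phi s) (phi (i :: s) x)) ->
  forall s, (size s <= l)%N -> forall x, U x -> pds s (phi [::]) x = phi s x.
Proof.
move=> oU H; elim=> [//|i s IH] /= sl x Ux; rewrite /pderiv.
have Hs := H s i x sl Ux; rewrite -[RHS](derive_val (is_derive := Hs)).
apply: near_eq_derive.
have : \forall y \near x, U y by apply: open_nbhs_nbhs.
by apply: filterS => y Uy; apply: IH => //; exact: ltnW.
Qed.

Lemma prod_idx (w : 'I_n -> R) a : \prod_(i <- idx a) w i = \prod_i w i ^+ a i.
Proof.
rewrite /idx big_flatten big_map big_enum/=; apply: eq_bigr => i _.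
by rewrite big_nseq -Monoid.iteropE.
Qed.

Lemma pds_sub_network U l (f : 'rV[R]_n -> R) sigma N (W : 'I_N -> R) b C :
  open U -> Cl_on U l f ->
  (forall j, (j < l)%N -> forall t : R,
     is_derive t 1 (derive1n j sigma) (derive1n j.+1 sigma t)) ->
  forall a x, (mdeg a <= l)%N -> U x ->
  pds (idx a) (fun x => f x - network sigma W b C x) x = pds (idx a) f x -
   \sum_(j < N) W j * ridge (fun k => derive1n k sigma) (fun i => C j 0 i) (b j) a x.
Proof.
move=> oU fU Hs a x al Ux.
pose nphi (s : seq 'I_n) (j : 'I_N) x := (W j * \prod_(i <- s) C j 0 i) *
     derive1n (size s) sigma (\sum_i C j 0 i * x 0 i + b j).
pose phi s x := pds s f x - \sum_(j < N) nphi s j x.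
have -> : (fun x => f x - network sigma W b C x) = phi [::].
  apply/funext => y; rewrite /phi /network /nphi /=; congr (_ - _).
  by apply: eq_bigr => j _; rewrite big_nil mulr1.
have J s i y : (size s < l)%N -> U y -> is_derive y (evec R i) (phi s) (phi (i :: s) y).
  move=> sl Uy.
  have -> : phi s = pds s f - \sum_(j < N) nphi s j.
    by apply/funext => z; rewrite /phi !fctE fct_sumE.
  apply: is_deriveB; first by split => //; exact: fU.1.
  have -> : \sum_(j < N) nphi (i :: s) j y = \sum_(j < N)
     (W j * (\prod_(i <- s) C j 0 i) * C j 0 i *
       derive1n (size s).+1 sigma (\sum_i C j 0 i * y 0 i + b j)).
    by apply: eq_bigr => j _; rewrite /nphi big_cons /=; ring.
  apply: is_derive_sum => j; apply: is_derive_ridge; exact: Hs.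
rewrite (pds_jet oU J) ?size_idx// /phi; congr (_ - _); apply: eq_bigr => j _.
by rewrite /nphi /ridge size_idx prod_idx mulrA.
Qed.

End network_derivatives.

(** * Continuity of neurons in their parameters, uniformly on K *)

Section parameter_continuity.
Context {R : realType} (n l : nat) (K : set 'rV[R]_n) (th : nat -> R -> R) (A : R).
Hypotheses (A1 : 1 <= A) (KA : forall x i, K x -> `|x 0 i| <= A).
Hypothesis cth : chain l th.

Lemma prod_perturb (I : Type) (r : seq I) (w : I -> R) e : 0 < e ->
  exists2 d, 0 < d & forall v, (forall i, `|v i - w i| <= d) ->
    `|\prod_(i <- r) v i - \prod_(i <- r) w i| <= e.
Proof.
elim: r e => [|i r IH] e e0.
  by exists 1 => // v _; rewrite !big_nil subrr normr0 ltW.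
have e20 : 0 < e / 2 by rewrite divr_gt0.
have [e1 e10 He1] : exists2 e1, 0 < e1 & (`|w i| + 1) * e1 <= e / 2.
  by apply: small_bound => //; rewrite addr_ge0.
have [e2 e20' He2] := small_bound (normr_ge0 (\prod_(i <- r) w i)) e20.
have [d d0 Hd] := IH _ e10.
exists (Num.min 1 (Num.min d e2)); first by rewrite !lt_min ltr01 d0.
move=> v Hv; rewrite !big_cons.
have h1 k : `|v k - w k| <= 1 by apply: le_trans (Hv k) _; rewrite ge_min lexx.
have h2 k : `|v k - w k| <= d.
  by apply: le_trans (Hv k) _; rewrite !ge_min lexx orbT.
have h3 k : `|v k - w k| <= e2.
  by apply: le_trans (Hv k) _; rewrite !ge_min lexx !orbT.
set p := \prod_(j <- r) v j; set q := \prod_(j <- r) w j in He2 *.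
have -> : v i * p - w i * q = v i * (p - q) + q * (v i - w i) by ring.
apply: le_trans (ler_normD _ _) _; rewrite !normrM [leRHS]splitr lerD//.
  apply: le_trans He1; apply: ler_pM => //; last exact: Hd.
  rewrite -[v i](subrK (w i)); apply: le_trans (ler_normD _ _) _.
  by rewrite addrC lerD2l.
by apply: le_trans He2; apply: ler_wpM2l.
Qed.

Lemma ridge_perturb (w : 'I_n -> R) b a e : 0 < e -> (mdeg a <= l)%N ->
  exists2 d, 0 < d & forall v c, (forall i, `|v i - w i| <= d) -> `|c - b| <= d ->
    forall x, K x -> `|ridge th v c a x - ridge th w b a x| <= e.
Proof.
move=> e0 al; have [D D1 HD] := affine_bounded A1 KA w b.
have [B B0 HB] := chain_bounded D cth.
have e20 : 0 < e / 2 by rewrite divr_gt0.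
have [e1 e10 He1] : exists2 e1, 0 < e1 & (`|\prod_i w i ^+ a i| + 1) * e1 <= e / 2.
  by apply: small_bound => //; rewrite addr_ge0.
have [e2 e20' He2] := small_bound (ltW B0) e20.
have m0 : 0 < Num.min 1 e2 by rewrite lt_min ltr01.
have [d1 d10 Hd1] := prod_perturb (idx a) w m0.
have [d2 d20 Hd2] := chain_unif_continuous D cth e10.
have d220 : 0 < d2 / 2 by rewrite divr_gt0.
(* A parameter change of at most [d3] moves the argument of [th] by at most [(n * A + 1) * d3];
   halving [d2] gives the strict inequality. *)
have [d3 d30 Hd3] : exists2 d3, 0 < d3 & (n%:R * A + 1) * d3 <= d2 / 2.
  by apply: small_bound => //; rewrite addr_ge0// mulr_ge0// (le_trans _ A1).
exists (Num.min d1 d3); first by rewrite lt_min d10.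
move=> v c Hv Hc x Kx; rewrite /ridge.
have pq : `|\prod_i v i ^+ a i - \prod_i w i ^+ a i| <= Num.min 1 e2.
  rewrite -!prod_idx; apply: Hd1 => i; apply: le_trans (Hv i) _.
  by rewrite ge_min lexx.
set p := \prod_i v i ^+ a i in pq *; set q := \prod_i w i ^+ a i in pq He1 *.
set yv := \sum_i v i * x 0 i + c; set yw := \sum_i w i * x 0 i + b.
have -> : p * th (mdeg a) yv - q * th (mdeg a) yw =
  p * (th (mdeg a) yv - th (mdeg a) yw) + th (mdeg a) yw * (p - q) by ring.
move: pq; rewrite le_min => /andP[pq1 pq2].
apply: le_trans (ler_normD _ _) _; rewrite !normrM [leRHS]splitr lerD//; last first.
  apply: le_trans He2; apply: ler_pM => //; apply: HB => //; exact: (HD xpredT).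
apply: le_trans He1; apply: ler_pM => //.
  rewrite -[p](subrK q); apply: le_trans (ler_normD _ _) _.
  by rewrite addrC lerD2l.
rewrite distrC; apply: Hd2 => //; first exact: (HD xpredT).
apply: (@le_lt_trans _ _ (d2 / 2)); last by rewrite ltr_pdivrMr//; lra.
apply: le_trans Hd3; rewrite distrC.
have -> : yv - yw = \sum_i (v i - w i) * x 0 i + (c - b).
  rewrite /yv /yw opprD addrACA -sumrB; congr (_ + _).
  by apply: eq_bigr => i _; rewrite mulrBl.
apply: le_trans (ler_normD _ _) _; rewrite mulrDl mul1r; apply: lerD; last first.
  by apply: le_trans Hc _; rewrite ge_min lexx orbT.
apply: le_trans (ler_norm_sum _ _ _) _.
have -> : n%:R * A * d3 = \sum_(i < n) d3 * A.
  by rewrite sumr_const card_ord -[RHS]mulr_natl; ring.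
apply: ler_sum => i _; rewrite normrM; apply: ler_pM => //; last exact: KA.
by apply: le_trans (Hv i) _; rewrite ge_min lexx orbT.
Qed.

Lemma ridge_open_nbhd (w : 'I_n -> R) b e : 0 < e ->
  exists O : set 'rV[R]_(1 + n), [/\ open O, O !=set0 &
    forall c (C : 'rV[R]_n), O (pairvec c C) ->
      jet_close l K e (ridge th (fun i => C 0 i) c) (ridge th w b)].
Proof.
move=> e0.
have [||d d0 Hd] := @finite_pos_bound R {ffun 'I_n -> 'I_l.+1}
  (fun a d => (mdeg (fun i => a i : nat) <= l)%N -> forall v c,
     (forall i, `|v i - w i| <= d) -> `|c - b| <= d ->
     forall x, K x -> `|ridge th v c (fun i => a i : nat) x -
       ridge th w b (fun i => a i : nat) x| <= e).
- move=> a; have [al|al] := leqP (mdeg (fun i => a i : nat)) l; last by exists 1.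
  have [d d0 Hd] := ridge_perturb w b e0 al.
  by exists d => // _.
- move=> a d d' dd' H al v c Hv Hc; apply: H => // [i|]; exact: le_trans dd'.
pose p0 := pairvec b (\row_i w i).
exists (ball p0 d); split.
- exact: ball_open.
- by exists p0; exact: ballxx.
move=> c C; rewrite -ball_normE /= => hp a x al Kx; move: a al.
apply: multi_index_finite => a al; apply: Hd => //.
- move=> i; have := norm_coord_le (p0 - pairvec c C) (rshift 1 i).
  rewrite [X in `|X|]mxE [X in _ + X]mxE /p0 /pairvec !row_mxEr mxE distrC => h.
  by apply: le_trans h (ltW _).
- have := norm_coord_le (p0 - pairvec c C) (lshift n ord0).
  rewrite [X in `|X|]mxE [X in _ + X]mxE /p0 /pairvec !row_mxEl !mxE distrC => h.
  by apply: le_trans h (ltW _).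
Qed.

End parameter_continuity.

Lemma Crnorm_le (R : realType) (n r : nat) (K : set 'rV[R]_n) (h : 'rV[R]_n -> R) e :
  0 <= e ->
  (forall a x, (mdeg a <= r)%N -> K x -> `|pds (idx a) h x| <= e) ->
  Crnorm r K h <= e * #|{ffun 'I_n -> 'I_r.+1}|%:R.
Proof.
move=> e0 H; rewrite /Crnorm.
apply: (@le_trans _ _ (\sum_(a : {ffun 'I_n -> 'I_r.+1}) e)); last first.
  by rewrite sumr_const mulr_natr.
rewrite [leRHS](bigID (fun a : {ffun 'I_n -> 'I_r.+1} => (morder a <= r)%N))/=.
rewrite -[leLHS]addr0 lerD ?sumr_ge0//; apply: ler_sum => a al.
(* For empty [K] every supremum is that of the empty set, which is 0 by convention. *)
have [->|/set0P K0] := eqVneq K set0; first by rewrite image_set0 sup0.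
apply: ge_sup; first by case: K0 => x Kx; exists `|pdm a h x|; exists x.
by move=> _ [x Kx <-]; exact: (H (fun i => a i : nat)).
Qed.

Unset Implicit Arguments.

Theorem mainTheorem15 (R : realType) (n : nat) (K : set 'rV[R]_n) (l : nat)
  (U : set 'rV[R]_n) (f : 'rV[R]_n -> R) (sigma : R -> R)
  (d : measure_display) (Omega : measurableType d) (P : probability Omega R)
  (b : nat -> Omega -> R) (C : nat -> Omega -> 'rV[R]_n) :
  compact K -> open U -> K `<=` U -> Cl_on U l f ->
  l_finite l sigma ->
  iid_full_support P (fun j w => pairvec (b j w) (C j w)) ->
  forall (r : nat) (alpha eps : R),
    (r <= l)%N -> 0 < alpha < 1 -> 0 < eps ->
    exists N : nat, (0 < N)%N /\
      exists E : set Omega, measurable E /\ (alpha%:E < P E)%E /\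
        forall w, E w ->
          exists W : 'I_N -> R,
            Crnorm r K (fun x => f x - network sigma W (fun j => b j w) (fun j => C j w) x)
              < eps.
Proof.
move=> cK oU KU fU [[dsig csig] /andP[sig0 sigoo]] iid r alpha eps rl /andP[_ alpha1] eps0.
pose s0 k := derive1n k sigma.
have cs0 : chain l s0.
  split => // j jl t; apply: DeriveDef; first exact: dsig.
  by rewrite /s0 derive1nS derive1E.
have cs0l : continuous (s0 l) := cs0.2 l (leqnn l).
have ds0 : dominated_primitive (s0 l).
  have can : continuous (fun t => `|s0 l t|).
    by move=> t; apply: continuous_comp; [exact: cs0l|exact: norm_continuous].
  have [H dH] := antiderivative_continuous can.
  have [B HB] := antiderivative_bounded can (fun t => normr_ge0 _) sigoo dH.
  by exists H, (fun t => `|s0 l t|), B; split.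
have ns0 : exists t, s0 l t != 0.
  apply: contrapT => hn; move: sig0; rewrite integral0_eq ?ltxx// => t _.
  suff -> : derive1n l sigma t = 0 by rewrite normr0.
  by apply/eqP/contraT => h; exfalso; apply: hn; exists t.
have [A A1 KA] : exists2 A, 1 <= A & forall x i, K x -> `|x 0 i| <= A.
  have [A [_ HA]] := compact_bounded cK.
  exists (Num.max 1 (A + 1)); first by rewrite le_max lexx.
  move=> x i Kx; rewrite le_max; apply/orP; right.
  by apply: le_trans (norm_coord_le x i) _; apply: HA => //; rewrite ltrDl.
have apf : approximable l K s0 (fun a => pds (idx a) f).
  apply: (approximable_smooth_function cK oU KU fU KA).
  apply: (approximable_tensor KA) => k.
  exact: (approximable_monomials A1 KA k cs0 ds0 ns0).
have cd0 : 0 < #|{ffun 'I_n -> 'I_r.+1}|.+1%:R :> R by rewrite ltr0n.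
(* The extra 1 in the denominator makes the final bound on the norm strict. *)
pose e := eps / #|{ffun 'I_n -> 'I_r.+1}|.+1%:R.
have e0 : 0 < e by rewrite divr_gt0.
have e20 : 0 < e / 2 by rewrite divr_gt0.
have [s cs] := apf _ e20.
pose dflt : R * R * ('I_n -> R) := (0, 0, fun=> 0).
pose nr p := nth dflt s p.
have L0 : 0 <= \sum_(p < size s) `|(nr p).1.1| by apply: sumr_ge0.
have [e1 e10 He1] := small_bound L0 e20.
(* Any neuron with parameters in [V p] imitates the [p]-th neuron of the deterministic network
   within [e1]. *)
have /choice[V HV] := fun p => ridge_open_nbhd A1 KA cs0 (nr p).2 (nr p).1.2 e10.
have [N N0 [E [mE PE HE]]] := @hit_all_open R d Omega P (1 + n) _ (size s) V alpha iid
  (fun p => let: And3 h _ _ := HV p in h) (fun p => let: And3 _ h _ := HV p in h) alpha1.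
exists N; split => //; exists E; split => //; split => // w Ew.
have /choice[jj Hjj] : forall p : 'I_(size s), exists j : 'I_N,
    V p (pairvec (b j w) (C j w)).
  by move=> p; have [j jN Oj] := HE w Ew p (ltn_ord p); exists (Ordinal jN).
(* Several target neurons may be assigned to the same sample, so their coefficients are added; a
   sample assigned to none gets weight 0. *)
exists (fun j => \sum_(p | jj p == j) (nr p).1.1).
apply: (@le_lt_trans _ _ (e * #|{ffun 'I_n -> 'I_r.+1}|%:R)); last first.
  by rewrite /e mulrAC ltr_pdivrMr// ltr_pM2l// ltr_nat.
apply: Crnorm_le; first exact: ltW.
move=> a x ar Kx; have al := leq_trans ar rl.
rewrite (@pds_sub_network R n U l f sigma N _ _ _ oU fU cs0.1 a x al (KU x Kx)).
pose rd (j : 'I_N) := ridge s0 (fun i => C j w 0 i) (b j w) a x.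
have -> : \sum_(j < N) (\sum_(p | jj p == j) (nr p).1.1) *
    ridge (fun k => derive1n k sigma) (fun i => C j w 0 i) (b j w) a x =
    \sum_(p < size s) (nr p).1.1 * rd (jj p).
  rewrite (partition_big jj xpredT)//=; apply: eq_bigr => j _.
  by rewrite mulr_suml; apply: eq_bigr => p /eqP <-.
(* Half of [e] pays for the deterministic network, the other half for replacing its neurons by
   sampled ones. *)
rewrite -[pds _ _ _](subrK (net s0 s a x)) -addrA [e]splitr.
apply: le_trans (ler_normD _ _) _; apply: lerD; first exact: cs.
have -> : net s0 s a x =
    \sum_(p < size s) (nr p).1.1 * ridge s0 (nr p).2 (nr p).1.2 a x.
  by rewrite /net (big_nth dflt) big_mkord.
rewrite -sumrB; apply: le_trans (ler_norm_sum _ _ _) _; apply: le_trans He1.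
rewrite mulr_suml; apply: ler_sum => p _; rewrite -mulrBr normrM.
apply: ler_wpM2l => //; rewrite distrC.
by have [_ _ H] := HV p; exact: (H _ _ (Hjj p)).
Qed.
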